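(* Let $p> q\geq 1$ be integers with $\gcd(p,q)=1$, and let $M_{p,q}=G/K_{p,q}$ with $G=\mathrm{SU}(2)^2$, with the $G$-invariant metric $g_o$ and the $G$-invariant closed $3$-form $H_o$ defined in the context; $(g_o,H_o)$ is a fixed point of the generalized Ricci flow. Let $\lambda>0$, let $g$ be any $G$-invariant Riemannian metric on $M_{p,q}$, and consider the $G$-invariant solution $(g_t,H_t)$ of the generalized Ricci flow starting at $t=t_o$ from the pair $(g,\lambda H_o)$. Then $H_t=\lambda H_o$ for all $t$, the solution exists for all $t\geq t_o$, and $g_t$ converges to $\lambda g_o$ as $t\to+\infty$. Moreover, the pair $(\lambda g_o,\lambda H_o)$ is asymptotically stable, in the sense that $\lambda g_o$ is an asymptotically stable fixed point of the system of ODEs induced by the flow on the ($3$-dimensional) space of $G$-invariant metrics with $H_t=\lambda H_o$ fixed.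
   Context: Generalized Ricci flow: given a closed $3$-form $H_0$ on $M$, a family of Riemannian metrics $g_t$ and a family of $2$-forms $b_t$, put $H_t=H_0+db_t$; the flow is $$\frac{\partial}{\partial t}g_t=-2\,\mathrm{Ric}_{g_t}+\tfrac12H_t^2,\qquad \frac{\partial}{\partial t}b_t=-\delta_{g_t}H_t,$$ where $\delta_{g}$ is the formal adjoint of $d$ and $H^2(X,Y)=g(\iota_XH,\iota_YH)=\sum_{i,j}H(X,v_i,v_j)H(Y,v_i,v_j)$ for a local $g$-orthonormal frame $(v_i)$. ''Starting from $(g,\lambda H_o)$ at $t_o$'' means $g_{t_o}=g$, $H_0=\lambda H_o$, $b_{t_o}=0$. The subgroup is $K_{p,q}=\{(\mathrm{diag}(z^p,z^{-p}),\mathrm{diag}(z^q,z^{-q})) : z\in\mathbb{C},|z|=1\}\subset \mathrm{SU}(2)^2$. In $\mathfrak{su}(2)$ put $$\mathsf{H}=\begin{pmatrix}\frac i2&0\\0&-\frac i2\end{pmatrix},\quad \mathsf{E}=\begin{pmatrix}0&\frac1{2\sqrt2}\\-\frac1{2\sqrt2}&0\end{pmatrix},\quad \mathsf{V}=\begin{pmatrix}0&\frac i{2\sqrt2}\\\frac i{2\sqrt2}&0\end{pmatrix},$$ and in $\mathfrak{su}(2)\oplus\mathfrak{su}(2)$ put $e_1=(q\mathsf{H},-p\mathsf{H})$, $e_2=(\mathsf{E},0)$, $e_3=(\mathsf{V},0)$, $e_4=(0,\mathsf{E})$, $e_5=(0,\mathsf{V})$. The span $\mathfrak{m}$ of $e_1,\dots,e_5$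 is an $\mathrm{Ad}(K_{p,q})$-invariant complement of the Lie algebra of $K_{p,q}$ and is identified with the tangent space of $M_{p,q}$ at $eK_{p,q}$; $G$-invariant tensors on $M_{p,q}$ are identified with $\mathrm{Ad}(K_{p,q})$-invariant tensors on $\mathfrak{m}$. Let $(e^1,\dots,e^5)$ be the dual basis and $e^{ijk}=e^i\wedge e^j\wedge e^k$. For $p\neq q$ every $G$-invariant metric has the form $\mu^2e^1\otimes e^1+a^2(e^2\otimes e^2+e^3\otimes e^3)+b^2(e^4\otimes e^4+e^5\otimes e^5)$ with $\mu,a,b>0$, and every $G$-invariant closed $3$-form is a real multiple of $H_o$. The metric $g_o$ and the form $H_o$ are $$g_o=2(p^2+q^2)\,e^1\otimes e^1+\frac{q^2}{p^2+q^2}(e^2\otimes e^2+e^3\otimes e^3)+\frac{p^2}{p^2+q^2}(e^4\otimes e^4+e^5\otimes e^5),\qquad H_o=q\,e^{123}+p\,e^{145}.$$ *)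

(* Defs.v *)
From HB Require Import structures.
From mathcomp Require Import all_boot all_order all_algebra.
From mathcomp Require Import complex.
From mathcomp Require Import all_classical all_reals all_analysis.
Set Implicit Arguments.
Unset Strict Implicit.
Unset Printing Implicit Defensive.
Import Order.TTheory GRing.Theory Num.Theory.
Import numFieldNormedType.Exports.
Local Open Scope classical_set_scope.
Local Open Scope complex_scope.
Local Open Scope ring_scope.

(* Conventions.  The Lie algebra su(2)+su(2) is realized by pairs of 2x2      *)
(* complex matrices; the reductive complement m = T_{eK}(G/K) is 'rV[R]_5     *)
(* through coordinates in the basis e_1, ..., e_5, indexed here from 0 to 4.  *)
(* G-invariant tensors on G/K are Ad(K)-invariant tensors on m: a metric or a *)
(* 2-form is its Gram matrix in this basis, a 3-form its array of components. *)

Section HomogeneousSpace.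
Variable R : realType.
Variables p q : nat.

Definition pairmx : Type := ('M[R[i]]_2 * 'M[R[i]]_2)%type.

Definition mx22 (a b c d : R[i]) : 'M[R[i]]_2 :=
  \matrix_(i, j) if i == 0 then (if j == 0 then a else b)
                 else (if j == 0 then c else d).

Definition suH : 'M[R[i]]_2 := mx22 (0 +i* 2^-1) 0 0 (0 -i* 2^-1).
Definition suE : 'M[R[i]]_2 :=
  mx22 0 ((2 * Num.sqrt 2)^-1)%:C (- (2 * Num.sqrt 2)^-1)%:C 0.
Definition suV : 'M[R[i]]_2 :=
  mx22 0 (0 +i* (2 * Num.sqrt 2)^-1) (0 +i* (2 * Num.sqrt 2)^-1) 0.

Definition lie (x y : pairmx) : pairmx :=
  (x.1 *m y.1 - y.1 *m x.1, x.2 *m y.2 - y.2 *m x.2).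

Definition Ad (k x : pairmx) : pairmx :=
  (k.1 *m x.1 *m invmx k.1, k.2 *m x.2 *m invmx k.2).

Definition Kpq : set pairmx :=
  [set k | exists2 z : R[i], `|z| = 1 &
     k = (mx22 (z ^+ p) 0 0 (z ^- p), mx22 (z ^+ q) 0 0 (z ^- q))].

(* velocity at theta = 0 of z = exp(i theta / 2): it spans the Lie algebra of *)
(* Kpq *)
Definition kgen : pairmx := (p%:R *: suH, q%:R *: suH).

Definition mbasis (i : 'I_5) : pairmx :=
  nth 0 [:: (q%:R *: suH, - (p%:R *: suH)); (suE, 0); (suV, 0);
            (0, suE); (0, suV)] i.

Definition of_m (X : 'rV[R]_5) : pairmx := \sum_i (X 0 i)%:C *: mbasis i.

(* the components of x along m and along the Lie algebra of K *)
Definition m_part (x : pairmx) : 'rV[R]_5 :=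
  xget 0 [set X | exists y : R, x = of_m X + y%:C *: kgen].
Definition k_part (x : pairmx) : pairmx := x - of_m (m_part x).

Definition br_m (X Y : 'rV[R]_5) : 'rV[R]_5 := m_part (lie (of_m X) (of_m Y)).
Definition br_k (X Y : 'rV[R]_5) : pairmx := k_part (lie (of_m X) (of_m Y)).

Definition ev (i : 'I_5) : 'rV[R]_5 := delta_mx 0 i.

Definition bil (b : 'M[R]_5) (X Y : 'rV[R]_5) : R := (X *m b *m Y^T) 0 0.

Definition AdK_invariant (b : 'M[R]_5) : Prop :=
  forall k, Kpq k -> forall X Y : 'rV[R]_5,
    bil b (m_part (Ad k (of_m X))) (m_part (Ad k (of_m Y))) = bil b X Y.

Definition inv_metrics : set 'M[R]_5 :=
  [set g | [/\ g^T = g, forall X : 'rV[R]_5, X != 0 -> 0 < bil g X X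
             & AdK_invariant g]].

Definition inv_2forms : set 'M[R]_5 :=
  [set b | b^T = - b /\ AdK_invariant b].

(* Levi-Civita connection of the invariant metric g as a bilinear map         *)
(* m x m -> m (Nomizu operator), given by Koszul's formula                    *)
(*   2 g(nabla_X Y, Z) = g([X,Y]_m, Z) - g([Y,Z]_m, X) + g([Z,X]_m, Y).       *)
Definition nabla (g : 'M[R]_5) (X Y : 'rV[R]_5) : 'rV[R]_5 :=
  2^-1 *: (\row_j (bil g (br_m X Y) (ev j) - bil g (br_m Y (ev j)) X
                   + bil g (br_m (ev j) X) Y) *m invmx g).

(* R(X,Y) = [nabla_X, nabla_Y] - nabla_{[X,Y]_m} - ad([X,Y]_k) *)
Definition curv (g : 'M[R]_5) (X Y Z : 'rV[R]_5) : 'rV[R]_5 :=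
  nabla g X (nabla g Y Z) - nabla g Y (nabla g X Z) - nabla g (br_m X Y) Z
  - m_part (lie (br_k X Y) (of_m Z)).

(* Ric(Y,Z) is the trace of X |-> R(X,Y)Z *)
Definition Ric (g : 'M[R]_5) : 'M[R]_5 :=
  \matrix_(i, j) \sum_k (curv g (ev k) (ev i) (ev j)) 0 k.

Definition form3 : Type := 'I_5 -> 'I_5 -> 'I_5 -> R.

Definition iota3 (H : form3) (i : 'I_5) : 'M[R]_5 := \matrix_(j, k) H i j k.

(* Full contraction of two bilinear forms with the inverse metric, that is,   *)
(* sum_(i,j) A(v_i,v_j) B(v_i,v_j) for any g-orthonormal basis (v_i); see     *)
(* contract2_orthonormal below.                                               *)
Definition contract2 (g A B : 'M[R]_5) : R :=
  \tr (invmx g *m A *m invmx g *m B^T).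

Definition Hsq (g : 'M[R]_5) (H : form3) : 'M[R]_5 :=
  \matrix_(i, j) contract2 g (iota3 H i) (iota3 H j).

(* inner products on 2-forms and 3-forms (for which e^{i_1...i_k}, i_1 < ...  *)
(* < i_k, is orthonormal when (e_i) is) *)
Definition ip2 (g b c : 'M[R]_5) : R := 2^-1 * contract2 g b c.
Definition ip3 (g : 'M[R]_5) (H K : form3) : R :=
  6^-1 * \sum_i \sum_j invmx g i j * contract2 g (iota3 H i) (iota3 K j).

(* exterior derivative of an invariant 2-form *)
Definition d2 (b : 'M[R]_5) : form3 := fun i j k =>
  - bil b (br_m (ev i) (ev j)) (ev k) + bil b (br_m (ev i) (ev k)) (ev j)
  - bil b (br_m (ev j) (ev k)) (ev i).

(* w = delta_g H.  The L2 inner product of two invariant forms is their       *)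
(* (constant) pointwise inner product times the volume, and delta_g H is      *)
(* invariant when g and H are; by averaging over the compact group G, being   *)
(* the formal adjoint needs to be tested against invariant 2-forms only.      *)
Definition is_codiff (g : 'M[R]_5) (H : form3) (w : 'M[R]_5) : Prop :=
  inv_2forms w /\ forall b, inv_2forms b -> ip2 g w b = ip3 g H (d2 b).

(* (e^i /\ e^j /\ e^k)(e_a, e_b, e_c) *)
Definition wedge3 (i j k : 'I_5) : form3 := fun a b c =>
  \det (\matrix_(r < 3, s < 3)
          (tnth [tuple i; j; k] r == tnth [tuple a; b; c] s)%:R).

Definition H_o : form3 := fun a b c =>
  q%:R * wedge3 0 1 2 a b c + p%:R * wedge3 0 3 4 a b c.

Definition g_o : 'M[R]_5 :=
  let n : R := p%:R ^+ 2 + q%:R ^+ 2 in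
  diag_mx (\row_i nth 0 [:: 2 * n; q%:R ^+ 2 / n; q%:R ^+ 2 / n;
                            p%:R ^+ 2 / n; p%:R ^+ 2 / n] i).

Definition scale3 (c : R) (H : form3) : form3 := fun i j k => c * H i j k.

Definition metric_field (H : form3) (g : 'M[R]_5) : 'M[R]_5 :=
  (-2) *: Ric g + 2^-1 *: Hsq g H.

(* the 3-form H_t = H_0 + d b_t *)
Definition torsion (H0 : form3) (b : 'M[R]_5) : form3 :=
  fun i j k => H0 i j k + d2 b i j k.

Definition grf_fixed_point (g : 'M[R]_5) (H : form3) : Prop :=
  [/\ inv_metrics g, metric_field H g = 0 & is_codiff g H 0].

End HomogeneousSpace.

(* Derivative of y at t along J; at an endpoint of an interval J belonging to *)
(* J it is the one-sided derivative.                                          *)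
Definition derivative_within (R : realType) (V : normedModType R) (J : set R)
    (y : R -> V) (t : R) (v : V) : Prop :=
  (s - t)^-1 *: (y s - y t) @[s --> within (J `\ t) (nbhs t)] --> v.

(* Solution (g_t, b_t), for t in J, of the generalized Ricci flow starting    *)
(* from (g0, H0) at t0, among invariant metrics and invariant 2-forms.        *)
Definition grf_solution (R : realType) (p q : nat) (H0 : form3 R) (t0 : R)
    (g0 : 'M[R]_5) (J : set R) (g b : R -> 'M[R]_5) : Prop :=
  [/\ g t0 = g0, b t0 = 0 &
      forall t, J t ->
        [/\ inv_metrics p q (g t), inv_2forms p q (b t),
            derivative_within J g t
              (metric_field p q (torsion p q H0 (b t)) (g t)) &
            exists2 w, is_codiff p q (g t) (torsion p q H0 (b t)) w &
                       derivative_within J b t (- w)]].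

Definition ode_solution (R : realType) (V : normedModType R) (M : set V)
    (F : V -> V) (J : set R) (y : R -> V) : Prop :=
  forall t, J t -> M (y t) /\ derivative_within J y t (F (y t)).

(* x0 is an asymptotically stable fixed point of the autonomous system        *)
(* y' = F y on the phase space M; initial conditions are taken at time 0.     *)
Definition asymptotically_stable (R : realType) (V : normedModType R)
    (M : set V) (F : V -> V) (x0 : V) : Prop :=
  [/\ M x0, F x0 = 0,
      forall e : R, 0 < e -> exists2 d : R, 0 < d &
        forall (J : set R) (y : R -> V),
          is_interval J -> J 0 -> J `<=` `[0, +oo[ ->
          ode_solution M F J y -> `|y 0 - x0| < d ->
          forall t, J t -> `|y t - x0| < e &
      exists2 d : R, 0 < d &
        (forall y0, M y0 -> `|y0 - x0| < d ->
           exists2 y, ode_solution M F `[0, +oo[ y & y 0 = y0) /\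
        (forall y, ode_solution M F `[0, +oo[ y -> `|y 0 - x0| < d ->
           y t @[t --> +oo] --> x0)].

Lemma contract2_orthonormal (R : realType) (g v A B : 'M[R]_5) :
  v *m g *m v^T = 1%:M ->
  contract2 g A B =
    \sum_i \sum_j bil A (row i v) (row j v) * bil B (row i v) (row j v).
Proof.
move=> vgv.
have vU : v^T \in unitmx by case/mulmx1_unit: vgv.
have vU' : v \in unitmx by rewrite -unitmx_tr.
have gE : v^T *m v *m g = 1%:M.
  by rewrite -mulmxA; apply: mulmx1C.
have -> : contract2 g A B = \tr (v^T *m v *m A *m (v^T *m v) *m B^T).
  have gU : g \in unitmx by case/mulmx1_unit: gE.
  have -> // : v^T *m v = invmx g.
  by rewrite -[LHS]mulmx1 -(mulmxV gU) mulmxA gE mul1mx.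
have -> : v^T *m v *m A *m (v^T *m v) *m B^T =
          v^T *m ((v *m A *m v^T) *m (v *m B^T)) by rewrite !mulmxA.
rewrite mxtrace_mulC.
rewrite -(mulmxA (v *m A *m v^T)).
have -> : v *m B^T *m v^T = (v *m B *m v^T)^T.
  by rewrite !trmx_mul trmxK mulmxA.
have bilE (C : 'M[R]_5) i j : bil C (row i v) (row j v) = (v *m C *m v^T) i j.
  rewrite /bil !mxE; apply: eq_bigr => k _; rewrite !mxE; congr (_ * _).
  by apply: eq_bigr => l _; rewrite !mxE.
rewrite /mxtrace; apply: eq_bigr => i _; rewrite mxE.
by apply: eq_bigr => j _; rewrite !bilE [in X in _ * X]mxE.
Qed.

(* Main.v *)
Require Import Defs.
From HB Require Import structures.
From mathcomp Require Import all_boot all_order all_algebra.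
From mathcomp Require Import complex ring lra.
From mathcomp Require Import all_classical all_reals all_analysis.
Import Order.TTheory GRing.Theory Num.Theory.
Import numFieldNormedType.Exports.
Local Open Scope classical_set_scope.
Local Open Scope ring_scope.

(* Invariant 2-forms on [M_{p,q}] are closed, so the torsion and [b_t] do not
   move, and the flow reduces to an ODE for the diagonal metrics
   [m e^1 e^1 + x (e^2 e^2 + e^3 e^3) + y (e^4 e^4 + e^5 e^5)].  With
   [n = p^2 + q^2], [A = 2 n lam], [al = q^2 / 4n^2] and [be = p^2 / 4n^2] it reads
     m' = (A^2 - m^2) (al / x^2 + be / y^2),
     x' = (al / x) (m + A^2 / m) - 1,   y' = (be / y) (m + A^2 / m) - 1,
   with the only fixed point [(A, 2 al A, 2 be A)], i.e. [lam g_o].  Every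
   trajectory stays in a compact box of the positive octant, where the field is
   bounded and Lipschitz: clamping it to the box gives global existence (Picard
   iteration) and uniqueness (Gronwall).  In the box
   [K (m - A)^2 + (x - 2 al A)^2 + (y - 2 be A)^2] decays exponentially for [K]
   large, which gives both convergence and stability. *)

(** * Tensors on m in coordinates *)

Section Coordinates.
Variable R : realType.

(** The isotropy circle fixes [e_1] and rotates the planes (e_2, e_3) and (e_4, e_5) with speeds
    proportional to p and q. As q < p these speeds differ, so no invariant form couples the planes:
    invariant metrics are diagonal, and invariant 2-forms are combinations of e^{23} and e^{45}, the
    area forms of the factors of the base S^2 x S^2, which is why they are closed. The
    codifferential is tested against these forms alone, hence it vanishes on every 3-form.

    The reduced field blows up as an entry of the metric tends to 0, so no global Lipschitz theorem
    applies to it directly; the boxes are there for that. Their faces are dictated by two facts. The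
    sign of m' depends on m - A alone. And x' vanishes at x = al (m + A^2 / m) = al (2 A + (m - A)^2
    / m), which is never below 2 al A and is bounded above once m is confined; the same holds for y
    with be. This identity also shows that m - A disturbs x and y only to second order, so a
    multiple of (m - A)^2 is all that the weight K has to outweigh. *)

Lemma ord5_ind (P : 'I_5 -> Prop) :
  P 0 -> P 1 -> P 2 -> P 3 -> P 4 -> forall i, P i.
Proof.
move=> P0 P1 P2 P3 P4 [[|[|[|[|[|//]]]]] h].
- by rewrite (_ : Ordinal h = 0) //; apply/val_inj.
- by rewrite (_ : Ordinal h = 1) //; apply/val_inj.
- by rewrite (_ : Ordinal h = 2) //; apply/val_inj.
- by rewrite (_ : Ordinal h = 3) //; apply/val_inj.
- by rewrite (_ : Ordinal h = 4) //; apply/val_inj.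
Qed.

Lemma sum_ord5 (V : nmodType) (F : 'I_5 -> V) :
  \sum_i F i = F 0 + F 1 + F 2 + F 3 + F 4.
Proof.
rewrite !big_ord_recl big_ord0 addr0 !addrA.
by congr (_ + _ + _ + _ + _); congr F; apply/val_inj.
Qed.

Definition vec5 (a b c d e : R) : 'rV[R]_5 :=
  \row_i nth 0 [:: a; b; c; d; e] i.

Lemma vec5E a b c d e :
  (vec5 a b c d e 0 0 = a) * (vec5 a b c d e 0 1 = b) *
  (vec5 a b c d e 0 2 = c) * (vec5 a b c d e 0 3 = d) *
  (vec5 a b c d e 0 4 = e).
Proof. by do !split; rewrite mxE. Qed.

Lemma vec5_eta (X : 'rV[R]_5) :
  X = vec5 (X 0 0) (X 0 1) (X 0 2) (X 0 3) (X 0 4).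
Proof. by apply/rowP; elim/ord5_ind; rewrite vec5E. Qed.

Lemma evE : (@ev R 0 = vec5 1 0 0 0 0) * (@ev R 1 = vec5 0 1 0 0 0) *
  (@ev R 2 = vec5 0 0 1 0 0) * (@ev R 3 = vec5 0 0 0 1 0) *
  (@ev R 4 = vec5 0 0 0 0 1).
Proof.
by do !split; apply/rowP; elim/ord5_ind; rewrite vec5E /ev mxE eqxx /=.
Qed.

Lemma vec5Z l a b c d e :
  l *: vec5 a b c d e = vec5 (l * a) (l * b) (l * c) (l * d) (l * e).
Proof. by apply/rowP; elim/ord5_ind; rewrite mxE !vec5E. Qed.

(** The parameters are the squared lengths mu^2, a^2, b^2, not the lengths. They are unconstrained,
    so the same notation covers inverse metrics, Ricci tensors and velocities of the flow. *)
Definition Dg (m x y : R) : 'M[R]_5 := diag_mx (vec5 m x x y y).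

Lemma bil_Dg m x y a b c d e a' b' c' d' e' :
  bil (Dg m x y) (vec5 a b c d e) (vec5 a' b' c' d' e') =
  m * a * a' + x * (b * b' + c * c') + y * (d * d' + e * e').
Proof.
rewrite /bil mxE (sum_ord5 _ (fun j => _)) mul_mx_diag !mxE /=; ring.
Qed.

Lemma invmx_Dg m x y : 0 < m -> 0 < x -> 0 < y ->
  invmx (Dg m x y) = Dg m^-1 x^-1 y^-1.
Proof.
move=> m0 x0 y0.
have H : Dg m x y *m Dg m^-1 x^-1 y^-1 = 1%:M.
  rewrite /Dg mulmx_diag -diag_const_mx; congr diag_mx.
  by apply/rowP; elim/ord5_ind; rewrite !mxE /= ?mulfV ?gt_eqF.
have U : Dg m x y \in unitmx by case/mulmx1_unit: H.
by rewrite -[LHS]mulmx1 -H mulmxA mulVmx // mul1mx.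
Qed.

Lemma mul_vec5_Dg m x y a b c d e :
  vec5 a b c d e *m Dg m x y = vec5 (a * m) (b * x) (c * x) (d * y) (e * y).
Proof. by rewrite mul_mx_diag; apply/rowP; elim/ord5_ind; rewrite !mxE. Qed.

Lemma contract2_Dg m x y (A B : 'M[R]_5) : 0 < m -> 0 < x -> 0 < y ->
  let d := vec5 m^-1 x^-1 x^-1 y^-1 y^-1 in
  contract2 (Dg m x y) A B = \sum_i \sum_j d 0 i * d 0 j * (A i j * B i j).
Proof.
move=> m0 x0 y0 d; rewrite /contract2 invmx_Dg // /mxtrace.
apply: eq_bigr => i _; rewrite mxE; apply: eq_bigr => j _.
rewrite mul_mx_diag mxE mul_diag_mx mxE [B^T _ _]mxE -/d; ring.
Qed.

End Coordinates.
Arguments vec5 {R}.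
Arguments Dg {R}.

(** * The Lie algebra su(2) + su(2) and its reductive splitting *)

Section LieAlgebra.
Variable R : realType.
Local Open Scope complex_scope.
Local Notation kap := ((2 * Num.sqrt 2)^-1 : R).

Lemma kap2 : kap ^+ 2 = 8^-1.
Proof.
by rewrite exprVn exprMn sqr_sqrtr ?ler0n // -!natrX -natrM.
Qed.

Lemma kap_neq0 : kap != 0.
Proof. by apply/eqP => h; have := kap2; rewrite h; lra. Qed.

(** The matrix aH + bE + cV in closed form, see [suE']; [lie], [Ad] and [m_part] are computed on
    pairs of such matrices. *)
Definition su (a b c : R) : 'M[R[i]]_2 :=
  mx22 (0 +i* (a / 2)) ((b * kap) +i* (c * kap))
       (- (b * kap) +i* (c * kap)) (0 +i* - (a / 2)).

Lemma complex_eq (x y : R[i]) : complex.Re x = complex.Re y ->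
  complex.Im x = complex.Im y -> x = y.
Proof. by case: x y => [a b] [c d] /= -> ->. Qed.

Lemma ord2_ind (P : 'I_2 -> Prop) : P 0 -> P 1 -> forall i, P i.
Proof.
move=> P0 P1 [[|[|//]] h].
- by rewrite (_ : Ordinal h = 0) //; apply/val_inj.
- by rewrite (_ : Ordinal h = 1) //; apply/val_inj.
Qed.

Lemma mx22_eq (T : Type) (A B : 'M[T]_2) : A 0 0 = B 0 0 -> A 0 1 = B 0 1 ->
  A 1 0 = B 1 0 -> A 1 1 = B 1 1 -> A = B.
Proof.
by move=> h1 h2 h3 h4; apply/matrixP; elim/ord2_ind; elim/ord2_ind.
Qed.

Lemma mx22E (a b c d : R[i]) : (mx22 a b c d 0 0 = a) * (mx22 a b c d 0 1 = b) *
  (mx22 a b c d 1 0 = c) * (mx22 a b c d 1 1 = d).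
Proof. by do !split; rewrite mxE. Qed.

Lemma mulmx_mx22 (a b c d a' b' c' d' : R[i]) :
  mx22 a b c d *m mx22 a' b' c' d' =
  mx22 (a * a' + b * c') (a * b' + b * d') (c * a' + d * c') (c * b' + d * d').
Proof.
by apply: mx22_eq; rewrite !mxE !big_ord_recl big_ord0 !mxE /= addr0.
Qed.

Lemma suE' a b c : su a b c = a%:C *: suH R + b%:C *: suE R + c%:C *: suV R.
Proof.
by apply: mx22_eq; rewrite !mxE /=; apply: complex_eq; rewrite /=; ring.
Qed.

Lemma su_inj a b c a' b' c' : su a b c = su a' b' c' ->
  [/\ a = a', b = b' & c = c'].
Proof.
move=> /matrixP h; have := h 0 0; have := h 0 1; rewrite !mxE /=.
move=> [/(mulIf kap_neq0) -> /(mulIf kap_neq0) ->] [].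
by move=> /(mulIf (_ : 2^-1 != 0)) -> //; rewrite invr_eq0 pnatr_eq0.
Qed.

Lemma suD a b c a' b' c' : su a b c + su a' b' c' = su (a + a') (b + b') (c + c').
Proof.
by apply: mx22_eq; rewrite !mxE /=; apply: complex_eq; rewrite /=; ring.
Qed.

Lemma suN a b c : - su a b c = su (- a) (- b) (- c).
Proof.
by apply: mx22_eq; rewrite !mxE /=; apply: complex_eq; rewrite /=; ring.
Qed.

(** Encodes [H,E] = V, [H,V] = -E and [E,V] = H/2. The square root enters the H coordinate only
    through [kap ^+ 2], so it is replaced by a variable whose square is 1/8. *)
Lemma su_lie a b c a' b' c' :
  su a b c *m su a' b' c' - su a' b' c' *m su a b c =
  su ((b * c' - c * b') / 2) (- (a * c' - c * a')) (a * b' - b * a').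
Proof.
rewrite /su !mulmx_mx22; move: kap kap2 => k k2.
apply: mx22_eq; rewrite !mxE /=; apply: complex_eq; rewrite /=.
all: try by field.
all: apply/subr0_eq.
  transitivity (2 * (b * c' - c * b') * (k ^+ 2 - 8^-1)); first by field.
  by rewrite k2 subrr mulr0.
transitivity (2 * (c * b' - b * c') * (k ^+ 2 - 8^-1)); first by field.
by rewrite k2 subrr mulr0.
Qed.

End LieAlgebra.
Arguments su {R}.

Section LieAlgebra2.
Variables (R : realType) (p q : nat).
Hypotheses (p0 : (0 < p)%N) (q0 : (0 < q)%N).
Local Open Scope complex_scope.
Local Notation n := (p%:R ^+ 2 + q%:R ^+ 2 : R).
Local Notation P := (p%:R : R).
Local Notation Q := (q%:R : R).

Let n_gt0 : 0 < n.
Proof. by rewrite addr_gt0 // exprn_gt0 // ltr0n. Qed.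

Lemma mbasisE :
  (mbasis R p q 0 = (q%:R *: suH R, - (p%:R *: suH R))) *
  (mbasis R p q 1 = (suE R, 0)) * (mbasis R p q 2 = (suV R, 0)) *
  (mbasis R p q 3 = (0, suE R)) * (mbasis R p q 4 = (0, suV R)).
Proof. by []. Qed.

Let pair_expansion (H E V : 'M[R[i]]_2) (a b c d e y u v : R[i]) :
  a *: (v *: H, - (u *: H)) + b *: (E, 0) + c *: (V, 0) + d *: (0, E) +
    e *: (0, V) + y *: (u *: H, v *: H) =
  ((v * a + u * y) *: H + b *: E + c *: V,
   (- (u * a) + v * y) *: H + d *: E + e *: V).
Proof.
apply: injective_projections; rewrite /= !scaler0 ?addr0 ?scalerN !scalerDl
  ?scaleNr !scalerA [y * _]mulrC [a * _]mulrC -!addrA; congr (_ + _).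
  by rewrite addrA addrC.
by rewrite addrA addrC.
Qed.

Lemma of_mE a b c d e (y : R) :
  of_m p q (vec5 a b c d e) + y%:C *: kgen R p q =
  (su (Q * a + P * y) b c, su (- (P * a) + Q * y) d e).
Proof.
have pC k : (k%:R : R[i]) = (k%:R : R)%:C by rewrite rmorph_nat.
rewrite /of_m (sum_ord5 _ (fun i => _)) !vec5E !mbasisE /kgen pair_expansion.
by rewrite !suE' !pC !rmorphD !rmorphN !rmorphM.
Qed.

Lemma of_mE0 a b c d e :
  of_m p q (vec5 a b c d e) = (su (Q * a) b c, su (- (P * a)) d e).
Proof.
by have := of_mE a b c d e 0; rewrite scale0r addr0 !mulr0 !addr0.
Qed.

(** In the plane of the two H coordinates, [e_1] and [kgen] are (q, -p) and (p, q), orthogonal and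
    of squared length n > 0. The decomposition therefore exists and is unique, which determines the
    value picked by [xget]. *)
Lemma m_partE a b c a' b' c' :
  m_part p q (su a b c, su a' b' c') =
  vec5 ((Q * a - P * a') / n) b c b' c'.
Proof.
rewrite /m_part; case: xgetP => [X _ [y]|/(_ (vec5 ((Q * a - P * a') / n) b c b' c'))].
  rewrite (vec5_eta _ X) of_mE => -[/su_inj [-> -> ->] /su_inj [-> -> ->]].
  by congr vec5; field; rewrite ?(lt0r_neq0 n_gt0).
case; exists ((P * a + Q * a') / n); rewrite of_mE.
by congr (su _ _ _, su _ _ _); field; rewrite ?(lt0r_neq0 n_gt0).
Qed.

Lemma k_partE a b c a' b' c' :
  k_part p q (su a b c, su a' b' c') =
  (su (P * ((P * a + Q * a') / n)) 0 0, su (Q * ((P * a + Q * a') / n)) 0 0).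
Proof.
rewrite /k_part m_partE of_mE0.
have -> (A B C D : 'M[R[i]]_2) : (A, B) - (C, D) = (A - C, B - D) by [].
rewrite !suN !suD.
by congr (su _ _ _, su _ _ _); field; rewrite ?(lt0r_neq0 n_gt0).
Qed.

Lemma lieE a b c a' b' c' d e f d' e' f' :
  @lie R (su a b c, su d e f) (su a' b' c', su d' e' f') =
  (su ((b * c' - c * b') / 2) (- (a * c' - c * a')) (a * b' - b * a'),
   su ((e * f' - f * e') / 2) (- (d * f' - f * d')) (d * e' - e * d')).
Proof. by rewrite /lie /= !su_lie. Qed.

Lemma br_mE a b c d e a' b' c' d' e' :
  br_m p q (vec5 a b c d e) (vec5 a' b' c' d' e') =
  vec5 ((Q * (b * c' - c * b') - P * (d * e' - e * d')) / (2 * n))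
    (- (Q * (a * c' - c * a'))) (Q * (a * b' - b * a'))
    (P * (a * e' - e * a')) (- (P * (a * d' - d * a'))).
Proof.
rewrite /br_m !of_mE0 lieE m_partE.
by congr vec5; field; rewrite ?(lt0r_neq0 n_gt0).
Qed.

(** [t] is the coordinate of the isotropy part of [X,Y] along [kgen], which acts on m as an
    infinitesimal rotation of the two planes with speeds p and q. *)
Lemma br_k_actE a b c d e a' b' c' d' e' u v w u' v' :
  let t := (P * (b * c' - c * b') + Q * (d * e' - e * d')) / (2 * n) in
  m_part p q (lie (br_k p q (vec5 a b c d e) (vec5 a' b' c' d' e'))
    (of_m p q (vec5 u v w u' v'))) =
  vec5 0 (- (P * t * w)) (P * t * v) (- (Q * t * v')) (Q * t * u').
Proof.
rewrite /br_k !of_mE0 lieE k_partE lieE m_partE.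
by congr vec5; field; rewrite ?(lt0r_neq0 n_gt0).
Qed.

End LieAlgebra2.

(** * Ricci curvature of invariant metrics *)

Section Curvature.
Variables (R : realType) (p q : nat).
Hypotheses (p0 : (0 < p)%N) (q0 : (0 < q)%N).
Local Notation n := (p%:R ^+ 2 + q%:R ^+ 2 : R).
Local Notation P := (p%:R : R).
Local Notation Q := (q%:R : R).

Let n_gt0 : 0 < n.
Proof. by rewrite addr_gt0 // exprn_gt0 // ltr0n. Qed.

Lemma row_vec5 (F : 'I_5 -> R) :
  \row_j F j = vec5 (F 0) (F 1) (F 2) (F 3) (F 4).
Proof. by apply/rowP; elim/ord5_ind; rewrite vec5E mxE. Qed.

Lemma Dg_mxE (m x y : R) i j :
  Dg m x y i j = vec5 m x x y y 0 i *+ (i == j).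
Proof. by rewrite /Dg mxE. Qed.

Variables (m x y : R).
Hypotheses (m0 : 0 < m) (x0 : 0 < x) (y0 : 0 < y).

Let denE := (lt0r_neq0 n_gt0, lt0r_neq0 m0, lt0r_neq0 x0, lt0r_neq0 y0).

(** The metric enters only through the ratios [k] and [l]. One equation per coordinate, for
    arbitrary vectors, lets the nested connections of the curvature be expanded by rewriting. *)
Lemma nabla_coord (X Y : 'rV[R]_5) :
  let k := m * Q / (4 * n * x) in let l := m * P / (4 * n * y) in
  (nabla p q (Dg m x y) X Y 0 0 = (Q * (X 0 1 * Y 0 2 - X 0 2 * Y 0 1) -
     P * (X 0 3 * Y 0 4 - X 0 4 * Y 0 3)) / (4 * n)) *
  (nabla p q (Dg m x y) X Y 0 1 = (k - Q) * (X 0 0 * Y 0 2) + k * (X 0 2 * Y 0 0)) *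
  (nabla p q (Dg m x y) X Y 0 2 = (Q - k) * (X 0 0 * Y 0 1) - k * (X 0 1 * Y 0 0)) *
  (nabla p q (Dg m x y) X Y 0 3 = (P - l) * (X 0 0 * Y 0 4) - l * (X 0 4 * Y 0 0)) *
  (nabla p q (Dg m x y) X Y 0 4 = (l - P) * (X 0 0 * Y 0 3) + l * (X 0 3 * Y 0 0)).
Proof.
rewrite [X in nabla _ _ _ X](vec5_eta _ X) [Y in nabla _ _ _ _ Y](vec5_eta _ Y).
rewrite /nabla row_vec5 !evE !(br_mE _ _ _ p0 q0) !bil_Dg invmx_Dg //.
cbv zeta; rewrite mul_vec5_Dg vec5Z !vec5E.
by do !split; field; rewrite ?denE.
Qed.

Lemma br_m_coord (X Y : 'rV[R]_5) :
  (br_m p q X Y 0 0 = (Q * (X 0 1 * Y 0 2 - X 0 2 * Y 0 1) -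
     P * (X 0 3 * Y 0 4 - X 0 4 * Y 0 3)) / (2 * n)) *
  (br_m p q X Y 0 1 = - (Q * (X 0 0 * Y 0 2 - X 0 2 * Y 0 0))) *
  (br_m p q X Y 0 2 = Q * (X 0 0 * Y 0 1 - X 0 1 * Y 0 0)) *
  (br_m p q X Y 0 3 = P * (X 0 0 * Y 0 4 - X 0 4 * Y 0 0)) *
  (br_m p q X Y 0 4 = - (P * (X 0 0 * Y 0 3 - X 0 3 * Y 0 0))).
Proof.
rewrite [X in br_m _ _ X](vec5_eta _ X) [Y in br_m _ _ _ Y](vec5_eta _ Y).
by rewrite br_mE // !vec5E.
Qed.

Lemma br_k_act_coord (X Y Z : 'rV[R]_5) :
  let t := (P * (X 0 1 * Y 0 2 - X 0 2 * Y 0 1) +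
    Q * (X 0 3 * Y 0 4 - X 0 4 * Y 0 3)) / (2 * n) in
  let W := m_part p q (lie (br_k p q X Y) (of_m p q Z)) in
  (W 0 0 = 0) * (W 0 1 = - (P * t * Z 0 2)) * (W 0 2 = P * t * Z 0 1) *
  (W 0 3 = - (Q * t * Z 0 4)) * (W 0 4 = Q * t * Z 0 3).
Proof.
rewrite [X in br_k _ _ X](vec5_eta _ X) [Y in br_k _ _ _ Y](vec5_eta _ Y).
rewrite [Z in of_m _ _ Z](vec5_eta _ Z).
by cbv zeta; rewrite br_k_actE // !vec5E.
Qed.

Lemma curv_coord (X Y Z : 'rV[R]_5) (k : 'I_5) :
  curv p q (Dg m x y) X Y Z 0 k =
  nabla p q (Dg m x y) X (nabla p q (Dg m x y) Y Z) 0 k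
  - nabla p q (Dg m x y) Y (nabla p q (Dg m x y) X Z) 0 k
  - nabla p q (Dg m x y) (br_m p q X Y) Z 0 k
  - m_part p q (lie (br_k p q X Y) (of_m p q Z)) 0 k.
Proof.
have sub4 (A B C D : 'rV[R]_5) : (A - B - C - D) 0 k = A 0 k - B 0 k - C 0 k - D 0 k.
  by rewrite !mxE.
exact: sub4.
Qed.

Lemma ev_coord (i j : 'I_5) : ev R i 0 j = (j == i)%:R.
Proof. by rewrite mxE eqxx. Qed.

(* Stated for abstract operations: with the actual ones, rewriting tries to
   unfold the connection. *)
Let Ric_computation (nab br : 'rV[R]_5 -> 'rV[R]_5 -> 'rV[R]_5)
  (act : 'rV[R]_5 -> 'rV[R]_5 -> 'rV[R]_5 -> 'rV[R]_5) :
  (forall X Y : 'rV[R]_5, let k := m * Q / (4 * n * x) in let l := m * P / (4 * n * y) in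
  (nab X Y 0 0 = (Q * (X 0 1 * Y 0 2 - X 0 2 * Y 0 1) -
     P * (X 0 3 * Y 0 4 - X 0 4 * Y 0 3)) / (4 * n)) *
  (nab X Y 0 1 = (k - Q) * (X 0 0 * Y 0 2) + k * (X 0 2 * Y 0 0)) *
  (nab X Y 0 2 = (Q - k) * (X 0 0 * Y 0 1) - k * (X 0 1 * Y 0 0)) *
  (nab X Y 0 3 = (P - l) * (X 0 0 * Y 0 4) - l * (X 0 4 * Y 0 0)) *
  (nab X Y 0 4 = (l - P) * (X 0 0 * Y 0 3) + l * (X 0 3 * Y 0 0))) ->
  (forall X Y : 'rV[R]_5, (br X Y 0 0 = (Q * (X 0 1 * Y 0 2 - X 0 2 * Y 0 1) -
     P * (X 0 3 * Y 0 4 - X 0 4 * Y 0 3)) / (2 * n)) *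
  (br X Y 0 1 = - (Q * (X 0 0 * Y 0 2 - X 0 2 * Y 0 0))) *
  (br X Y 0 2 = Q * (X 0 0 * Y 0 1 - X 0 1 * Y 0 0)) *
  (br X Y 0 3 = P * (X 0 0 * Y 0 4 - X 0 4 * Y 0 0)) *
  (br X Y 0 4 = - (P * (X 0 0 * Y 0 3 - X 0 3 * Y 0 0)))) ->
  (forall X Y Z : 'rV[R]_5, let t := (P * (X 0 1 * Y 0 2 - X 0 2 * Y 0 1) +
    Q * (X 0 3 * Y 0 4 - X 0 4 * Y 0 3)) / (2 * n) in
  let W := act X Y Z in
  (W 0 0 = 0) * (W 0 1 = - (P * t * Z 0 2)) * (W 0 2 = P * t * Z 0 1) *
  (W 0 3 = - (Q * t * Z 0 4)) * (W 0 4 = Q * t * Z 0 3)) ->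
  forall i j, let e := ev R in
  \sum_k (nab (e k) (nab (e i) (e j)) 0 k - nab (e i) (nab (e k) (e j)) 0 k
    - nab (br (e k) (e i)) (e j) 0 k - act (e k) (e i) (e j) 0 k) =
  Dg (m ^+ 2 / (8 * n ^+ 2) * (Q ^+ 2 / x ^+ 2 + P ^+ 2 / y ^+ 2))
    (2^-1 - m * Q ^+ 2 / (8 * n ^+ 2 * x)) (2^-1 - m * P ^+ 2 / (8 * n ^+ 2 * y)) i j.
Proof.
move=> nabE brE actE i j e; rewrite /e {e} Dg_mxE (sum_ord5 _ (fun k => _)).
rewrite !actE !nabE !brE !ev_coord.
elim/ord5_ind: i; elim/ord5_ind: j; rewrite !vec5E /=.
all: by field; rewrite ?denE.
Qed.

(** M_{p,q} is a circle bundle over S^2 x S^2: the constant 1/2 is the Ricci tensor of each sphere,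
    independent of its scale, and the other terms come from the curvature of the bundle. *)
Lemma Ric_Dg : Ric p q (Dg m x y) =
  Dg (m ^+ 2 / (8 * n ^+ 2) * (Q ^+ 2 / x ^+ 2 + P ^+ 2 / y ^+ 2))
    (2^-1 - m * Q ^+ 2 / (8 * n ^+ 2 * x)) (2^-1 - m * P ^+ 2 / (8 * n ^+ 2 * y)).
Proof.
apply/matrixP => i j.
rewrite -(Ric_computation _ _ _ nabla_coord br_m_coord br_k_act_coord) mxE.
by apply: eq_bigr => k _; exact: curv_coord.
Qed.
End Curvature.

(** * The flow field on diagonal metrics with torsion a multiple of H_o *)

Section Flow.
Variables (R : realType) (p q : nat).
Hypotheses (p0 : (0 < p)%N) (q0 : (0 < q)%N).
Local Notation n := (p%:R ^+ 2 + q%:R ^+ 2 : R).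
Local Notation P := (p%:R : R).
Local Notation Q := (q%:R : R).

Let n_gt0 : 0 < n.
Proof. by rewrite addr_gt0 // exprn_gt0 // ltr0n. Qed.

Lemma det3E (A : 'M[R]_3) : \det A =
  A 0 0 * (A 1 1 * A 2 2 - A 1 2 * A 2 1)
  - A 0 1 * (A 1 0 * A 2 2 - A 1 2 * A 2 0)
  + A 0 2 * (A 1 0 * A 2 1 - A 1 1 * A 2 0).
Proof.
rewrite (expand_det_row _ 0) !big_ord_recl big_ord0 addr0 /cofactor.
rewrite !(expand_det_row _ ord0) !big_ord_recl !big_ord0 !addr0 /cofactor.
rewrite !det_mx11 !mxE.
(* Entries are read through natural-number indices, so that the ordinals produced by the cofactor
   expansions reduce to numerals. *)
have [F AE] : exists F : nat -> nat -> R, forall i j : 'I_3, A i j = F i j.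
  by exists (fun k l => A (inord k) (inord l)) => i j; rewrite !inord_val.
by rewrite !AE /= /bump /=; ring.
Qed.

Lemma H_oE a b c : H_o R p q a b c =
  match (val a, val b, val c) with
  | (0, 1, 2)%N | (1, 2, 0)%N | (2, 0, 1)%N => Q
  | (0, 2, 1)%N | (2, 1, 0)%N | (1, 0, 2)%N => - Q
  | (0, 3, 4)%N | (3, 4, 0)%N | (4, 0, 3)%N => P
  | (0, 4, 3)%N | (4, 3, 0)%N | (3, 0, 4)%N => - P
  | _ => 0
  end.
Proof.
rewrite /H_o /wedge3 !det3E !mxE.
have tE (T : eqType) (u v w : T) :
  (tnth [tuple u; v; w] 0 = u) * (tnth [tuple u; v; w] 1 = v) *
  (tnth [tuple u; v; w] 2 = w) by [].
rewrite !tE.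
elim/ord5_ind: a; elim/ord5_ind: b; elim/ord5_ind: c.
all: rewrite /=; ring.
Qed.

Variables (lam m x y : R).
Hypotheses (m0 : 0 < m) (x0 : 0 < x) (y0 : 0 < y).

Lemma Hsq_Dg : Hsq (Dg m x y) (scale3 lam (H_o R p q)) =
  Dg (lam ^+ 2 * (2 * Q ^+ 2 / x ^+ 2 + 2 * P ^+ 2 / y ^+ 2))
    (2 * lam ^+ 2 * Q ^+ 2 / (m * x)) (2 * lam ^+ 2 * P ^+ 2 / (m * y)).
Proof.
apply/matrixP => i j; rewrite Dg_mxE mxE contract2_Dg //.
rewrite (sum_ord5 _ (fun k => _)) !(sum_ord5 _ (fun k => _)) !vec5E !mxE.
rewrite /scale3 !H_oE.
elim/ord5_ind: i; elim/ord5_ind: j; rewrite /=.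
all: by field; rewrite ?lt0r_neq0.
Qed.

(** Along [e_1] the Ricci and torsion terms carry the same factor Q^2/x^2 + P^2/y^2, so the
    direction in which m moves depends on m alone. *)
Lemma metric_field_Dg :
  metric_field p q (scale3 lam (H_o R p q)) (Dg m x y) =
  Dg ((lam ^+ 2 - m ^+ 2 / (4 * n ^+ 2)) * (Q ^+ 2 / x ^+ 2 + P ^+ 2 / y ^+ 2))
    (Q ^+ 2 / x * (m / (4 * n ^+ 2) + lam ^+ 2 / m) - 1)
    (P ^+ 2 / y * (m / (4 * n ^+ 2) + lam ^+ 2 / m) - 1).
Proof.
rewrite /metric_field (Ric_Dg _ _ _ p0 q0) // Hsq_Dg.
apply/matrixP => i j; rewrite mxE [X in X + _]mxE [X in _ + X]mxE !Dg_mxE.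
case: (i == j); rewrite ?mulr0 ?addr0 //; elim/ord5_ind: i; rewrite !vec5E.
all: by field; rewrite ?lt0r_neq0.
Qed.

End Flow.

(** * Invariant tensors *)

Section Invariants.
Variables (R : realType) (p q : nat).
Hypotheses (p0 : (0 < p)%N) (q0 : (0 < q)%N).
Local Open Scope complex_scope.
Local Notation n := (p%:R ^+ 2 + q%:R ^+ 2 : R).
Local Notation P := (p%:R : R).
Local Notation Q := (q%:R : R).

Let n_gt0 : 0 < n.
Proof. by rewrite addr_gt0 // exprn_gt0 // ltr0n. Qed.

Lemma normc1_inv (w : R[i]) : `|w| = 1 -> w^-1 = complex.Re w -i* complex.Im w.
Proof.
move=> w1; have := normCK w; rewrite w1 expr1n => h.
have w0 : w != 0 by rewrite -normr_eq0 w1 oner_eq0.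
by apply: (mulfI w0); rewrite mulfV // h; case: w {w1 h w0}.
Qed.

Lemma normc1_sqr (w : R[i]) : `|w| = 1 ->
  complex.Re w ^+ 2 + complex.Im w ^+ 2 = 1.
Proof.
move=> w1; have := normCK w; rewrite w1 expr1n; case: w {w1} => u v [-> _] /=.
ring.
Qed.

(** Conjugation by diag(w, w^-1) fixes the diagonal and multiplies the upper right entry,
    proportional to b + ic, by w^2. *)
Lemma Ad_su (w : R[i]) a b c : `|w| = 1 ->
  mx22 w 0 0 w^-1 *m su a b c *m invmx (mx22 w 0 0 w^-1) =
  su a (complex.Re (w ^+ 2) * b - complex.Im (w ^+ 2) * c)
       (complex.Im (w ^+ 2) * b + complex.Re (w ^+ 2) * c).
Proof.
move=> w1; have w0 : w != 0 by rewrite -normr_eq0 w1 oner_eq0.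
have H : mx22 w 0 0 w^-1 *m mx22 w^-1 0 0 w = 1%:M.
  rewrite mulmx_mx22 !mul0r !mulr0 !addr0 !add0r mulfV // mulVf //.
  by apply: mx22_eq; rewrite !mxE.
have U : mx22 w 0 0 w^-1 \in unitmx by case/mulmx1_unit: H.
have -> : invmx (mx22 w 0 0 w^-1) = mx22 w^-1 0 0 w.
  by rewrite -[LHS]mulmx1 -H mulmxA mulVmx // mul1mx.
rewrite (normc1_inv _ w1); have := normc1_sqr _ w1.
case: w {w1 w0 H U} => u v /= uv; rewrite /su !mulmx_mx22.
move: ((2 * Num.sqrt 2)^-1) => k.
have vv : v ^+ 2 = 1 - u ^+ 2 by rewrite -uv; ring.
apply: mx22_eq; rewrite !mx22E; apply: complex_eq; rewrite /=; ring: vv.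
Qed.

Definition rot (C S C' S' : R) (X : 'rV[R]_5) : 'rV[R]_5 :=
  vec5 (X 0 0) (C * X 0 1 - S * X 0 2) (S * X 0 1 + C * X 0 2)
    (C' * X 0 3 - S' * X 0 4) (S' * X 0 3 + C' * X 0 4).

Lemma Ad_m_part (z : R[i]) (X : 'rV[R]_5) : `|z| = 1 ->
  m_part p q (Ad (mx22 (z ^+ p) 0 0 (z ^- p), mx22 (z ^+ q) 0 0 (z ^- q))
    (of_m p q X)) =
  rot (complex.Re (z ^+ p ^+ 2)) (complex.Im (z ^+ p ^+ 2))
    (complex.Re (z ^+ q ^+ 2)) (complex.Im (z ^+ q ^+ 2)) X.
Proof.
move=> z1; rewrite [in LHS](vec5_eta _ X) of_mE0 /Ad.
have fstE (A B : 'M[R[i]]_2) : (A, B).1 = A by [].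
have sndE (A B : 'M[R[i]]_2) : (A, B).2 = B by [].
rewrite !fstE !sndE !Ad_su ?normrX ?z1 ?expr1n // m_partE // /rot.
by congr vec5; field; rewrite ?(lt0r_neq0 n_gt0).
Qed.

Lemma de_moivre (t : R) k :
  (cos t +i* sin t) ^+ k = cos (k%:R * t) +i* sin (k%:R * t).
Proof.
elim: k => [|k IH]; first by rewrite mul0r cos0 sin0.
rewrite exprS IH -natr1 mulrDl mul1r cosD sinD.
by apply: complex_eq; rewrite /=; ring.
Qed.

(** A single element of K carries all the information needed: it rotates the two planes by angles in
    (0, pi) with distinct cosines. *)
Lemma generic_rotation (b : 'M[R]_5) : (q < p)%N -> AdK_invariant p q b ->
  exists C S C' S', [/\ C ^+ 2 + S ^+ 2 = 1, C' ^+ 2 + S' ^+ 2 = 1,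
    0 < S, 0 < S' /\ C != C' &
    forall X Y, bil b (rot C S C' S' X) (rot C S C' S' Y) = bil b X Y].
Proof.
(* With z = exp(i t), the rotation angles 2pt and 2qt are pi/4 and (pi/4)(q/p); they differ because
   q < p, and [cos] is injective on [0, pi]. *)
move=> qp inv; pose t : R := pi / (8 * P).
have P0 : 0 < P by rewrite ltr0n.
have Q0 : 0 < Q by rewrite ltr0n.
have QP : Q < P by rewrite ltr_nat.
have pi0 := pi_gt0 R.
pose z := cos t +i* sin t.
have z1 : `|z| = 1.
  by rewrite normc_def /= cos2Dsin2 sqrtr1.
have zk k : z ^+ k ^+ 2 = cos ((k%:R * 2) * t) +i* sin ((k%:R * 2) * t).
  by rewrite -exprM de_moivre natrM.
have tP : P * 2 * t = pi / 4 by rewrite /t; field; rewrite ?lt0r_neq0.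
have tQ : Q * 2 * t = pi / 4 * (Q / P) by rewrite /t; field; rewrite ?lt0r_neq0.
have QP0 : 0 < Q / P by rewrite divr_gt0.
have QP1 : Q / P < 1 by rewrite ltr_pdivrMr // mul1r.
exists (cos (P * 2 * t)), (sin (P * 2 * t)), (cos (Q * 2 * t)), (sin (Q * 2 * t)).
split.
- exact: cos2Dsin2.
- exact: cos2Dsin2.
- by rewrite tP; apply: sin_gt0_pi; lra.
- rewrite tP tQ; split; first by apply: sin_gt0_pi; nra.
  apply/eqP => /cos_inj; rewrite !in_itv /= => h.
  suff : pi / 4 = pi / 4 * (Q / P) by nra.
  by apply: h; nra.
- move=> X Y; have K : Kpq p q (mx22 (z ^+ p) 0 0 (z ^- p), mx22 (z ^+ q) 0 0 (z ^- q)).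
    by exists z.
  by have := inv _ K X Y; rewrite !Ad_m_part // !zk.
Qed.

Lemma bil_ev (b : 'M[R]_5) i j : bil b (ev R i) (ev R j) = b i j.
Proof. by rewrite /bil /ev -rowE trmx_delta -colE !mxE. Qed.

Lemma bilE (b : 'M[R]_5) (X Y : 'rV[R]_5) :
  bil b X Y = \sum_i \sum_j X 0 i * b i j * Y 0 j.
Proof.
rewrite /bil mxE exchange_big /=; apply: eq_bigr => j _.
by rewrite !mxE mulr_suml.
Qed.

(** The system for (u, v) has determinant (1 - C)^2 + S^2, nonzero as soon as the rotation is not
    the identity; the two combinations below are Cramer's rule. *)
Lemma rot_fixed (C S u v : R) : S != 0 \/ C != 1 ->
  u = C * u + S * v -> v = C * v - S * u -> u = 0 /\ v = 0.
Proof.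
move=> CS hu hv.
have k0 : 0 < (1 - C) ^+ 2 + S ^+ 2.
  rewrite lt0r addr_ge0 ?sqr_ge0 // paddr_eq0 ?sqr_ge0 // !sqrf_eq0 subr_eq0.
  by rewrite andbT; apply/negP => /andP[/eqP h1 /eqP h2]; case: CS;
    rewrite -?h1 ?h2 eqxx.
have hu' : u - (C * u + S * v) = 0 by rewrite -hu subrr.
have hv' : v - (C * v - S * u) = 0 by rewrite -hv subrr.
split; apply: (mulIf (lt0r_neq0 k0)); rewrite mul0r.
  transitivity ((1 - C) * (u - (C * u + S * v)) + S * (v - (C * v - S * u))).
    ring.
  by rewrite hu' hv' !mulr0 addr0.
transitivity ((1 - C) * (v - (C * v - S * u)) - S * (u - (C * u + S * v))).
  ring.
by rewrite hu' hv' !mulr0 subr0.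
Qed.

(** The trace-free symmetric part (d1 - d2, o1 + o2) of a 2x2 block turns by twice the angle, so it
    must vanish when S is nonzero; the trace and the antisymmetric part stay free. *)
Lemma rot_fixed_block (C S d1 d2 o1 o2 : R) : C ^+ 2 + S ^+ 2 = 1 -> S != 0 ->
  d1 = C ^+ 2 * d1 + C * S * (o1 + o2) + S ^+ 2 * d2 ->
  o1 = - (C * S * d1) + C ^+ 2 * o1 - S ^+ 2 * o2 + C * S * d2 ->
  o2 = - (C * S * d1) - S ^+ 2 * o1 + C ^+ 2 * o2 + C * S * d2 ->
  d1 = d2 /\ o1 + o2 = 0.
Proof.
move=> CS S0 h1 h2 h3.
have CE : C ^+ 2 = 1 - S ^+ 2 by rewrite -CS addrK.
have k1 : S * (d1 - d2) = C * (o1 + o2).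
  apply: (mulfI S0); rewrite CE in h1.
  by transitivity (S ^+ 2 * d1 - S ^+ 2 * d2); [ring | lra].
have k2 : S * (o1 + o2) = - (C * (d1 - d2)).
  apply: (mulfI S0); rewrite CE in h2 h3.
  by transitivity (S ^+ 2 * o1 + S ^+ 2 * o2); [ring | lra].
split; [apply/eqP; rewrite -subr_eq0; apply/eqP|].
  transitivity ((C ^+ 2 + S ^+ 2) * (d1 - d2)); first by rewrite CS mul1r.
  transitivity (C * (C * (d1 - d2)) + S * (S * (d1 - d2))); first by ring.
  rewrite k1 -[C * (d1 - d2)]opprK -k2; ring.
transitivity ((C ^+ 2 + S ^+ 2) * (o1 + o2)); first by rewrite CS mul1r.
transitivity (C * (C * (o1 + o2)) + S * (S * (o1 + o2))); first by ring.
rewrite k2 -k1; ring.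
Qed.

Lemma AdK_invariant_entries (b : 'M[R]_5) : (q < p)%N -> AdK_invariant p q b ->
  [/\ [/\ b 0 1 = 0, b 0 2 = 0, b 0 3 = 0 & b 0 4 = 0],
      [/\ b 1 3 = 0, b 1 4 = 0, b 2 3 = 0 & b 2 4 = 0],
      b 1 1 = b 2 2 /\ b 1 2 + b 2 1 = 0 & b 3 3 = b 4 4 /\ b 3 4 + b 4 3 = 0].
Proof.
move=> qp /(generic_rotation _ qp) [C [S [C' [S' [CS CS' S0 [S'0 CC'] h]]]]].
have E i j : b i j = bil b (rot C S C' S' (ev R i)) (rot C S C' S' (ev R j)).
  by rewrite h bil_ev.
have rE0 : rot C S C' S' (ev R 0) = vec5 1 0 0 0 0.
  by rewrite /rot evE !vec5E; congr vec5; ring.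
have rE1 : rot C S C' S' (ev R 1) = vec5 0 C S 0 0.
  by rewrite /rot evE !vec5E; congr vec5; ring.
have rE2 : rot C S C' S' (ev R 2) = vec5 0 (- S) C 0 0.
  by rewrite /rot evE !vec5E; congr vec5; ring.
have rE3 : rot C S C' S' (ev R 3) = vec5 0 0 0 C' S'.
  by rewrite /rot evE !vec5E; congr vec5; ring.
have rE4 : rot C S C' S' (ev R 4) = vec5 0 0 0 (- S') C'.
  by rewrite /rot evE !vec5E; congr vec5; ring.
have E01 := E 0 1; have E02 := E 0 2; have E03 := E 0 3; have E04 := E 0 4.
have E13 := E 1 3; have E14 := E 1 4; have E23 := E 2 3; have E24 := E 2 4.
have E11 := E 1 1; have E12 := E 1 2; have E21 := E 2 1.
have E33 := E 3 3; have E34 := E 3 4; have E43 := E 4 3.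
rewrite rE0 rE1 bilE sum_ord5 !sum_ord5 !vec5E in E01.
rewrite rE0 rE2 bilE sum_ord5 !sum_ord5 !vec5E in E02.
rewrite rE0 rE3 bilE sum_ord5 !sum_ord5 !vec5E in E03.
rewrite rE0 rE4 bilE sum_ord5 !sum_ord5 !vec5E in E04.
rewrite rE1 rE3 bilE sum_ord5 !sum_ord5 !vec5E in E13.
rewrite rE1 rE4 bilE sum_ord5 !sum_ord5 !vec5E in E14.
rewrite rE2 rE3 bilE sum_ord5 !sum_ord5 !vec5E in E23.
rewrite rE2 rE4 bilE sum_ord5 !sum_ord5 !vec5E in E24.
rewrite rE1 bilE sum_ord5 !sum_ord5 !vec5E in E11.
rewrite rE1 rE2 bilE sum_ord5 !sum_ord5 !vec5E in E12.
rewrite rE2 rE1 bilE sum_ord5 !sum_ord5 !vec5E in E21.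
rewrite rE4 rE3 bilE sum_ord5 !sum_ord5 !vec5E in E43.
rewrite rE3 bilE sum_ord5 !sum_ord5 !vec5E in E33.
rewrite rE3 rE4 bilE sum_ord5 !sum_ord5 !vec5E in E34.
have [Sn0 S'n0] := (lt0r_neq0 S0, lt0r_neq0 S'0).
have [|||u0 v0] := @rot_fixed C S (b 0 1) (b 0 2).
- by left.
- by rewrite [LHS]E01; ring.
- by rewrite [LHS]E02; ring.
have [|||u1 v1] := @rot_fixed C' S' (b 0 3) (b 0 4).
- by left.
- by rewrite [LHS]E03; ring.
- by rewrite [LHS]E04; ring.
(* The block coupling the two planes splits into two pairs, which turn by the difference and by the
   sum of the angles. If either rotation were trivial, (C - C')^2 + (S -+ S')^2 would be 0, against
   C != C'. *)
have CC2 : 0 < (C - C') ^+ 2 by rewrite exprn_even_gt0 //= subr_eq0.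
have [|||u2 v2] := @rot_fixed (C * C' + S * S') (S * C' - C * S')
   (b 1 3 + b 2 4) (b 2 3 - b 1 4).
- right; apply/eqP => k; have := sqr_ge0 (S - S').
  have : (C - C') ^+ 2 + (S - S') ^+ 2 =
    C ^+ 2 + S ^+ 2 + (C' ^+ 2 + S' ^+ 2) - 2 * (C * C' + S * S') by ring.
  by rewrite CS CS' k; clear -CC2; lra.
- by clear -E13 E24; lra.
- by clear -E23 E14; lra.
have [|||u3 v3] := @rot_fixed (C * C' - S * S') (S * C' + C * S')
   (b 1 3 - b 2 4) (b 2 3 + b 1 4).
- right; apply/eqP => k; have := sqr_ge0 (S + S').
  have : (C - C') ^+ 2 + (S + S') ^+ 2 =
    C ^+ 2 + S ^+ 2 + (C' ^+ 2 + S' ^+ 2) - 2 * (C * C' - S * S') by ring.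
  by rewrite CS CS' k; clear -CC2; lra.
- by clear -E13 E24; lra.
- by clear -E23 E14; lra.
split=> //.
- by clear -u2 v2 u3 v3; split; lra.
- apply: (rot_fixed_block C S) => //.
  + by rewrite [LHS]E11; ring.
  + by rewrite [LHS]E12; ring.
  + by rewrite [LHS]E21; ring.
- apply: (rot_fixed_block C' S') => //.
  + by rewrite [LHS]E33; ring.
  + by rewrite [LHS]E34; ring.
  + by rewrite [LHS]E43; ring.
Qed.

Lemma AdK_invariant_tr (b : 'M[R]_5) : AdK_invariant p q b ->
  AdK_invariant p q b^T.
Proof.
have bilT (X Y : 'rV[R]_5) : bil b^T X Y = bil b Y X.
  rewrite !bilE exchange_big; apply: eq_bigr => i _; apply: eq_bigr => j _.
  by rewrite mxE; ring.
by move=> inv k Kk X Y; rewrite !bilT inv.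
Qed.

(** [AdK_invariant_entries] annihilates entries above the diagonal only; those below are obtained
    from the transpose, which is invariant too. *)
Lemma AdK_invariant_mx (b : 'M[R]_5) : (q < p)%N -> AdK_invariant p q b ->
  b = Dg (b 0 0) (b 1 1) (b 3 3) + b 1 2 *: (delta_mx 1 2 - delta_mx 2 1)
    + b 3 4 *: (delta_mx 3 4 - delta_mx 4 3).
Proof.
move=> qp inv; have [[h1 h2 h3 h4] [h5 h6 h7 h8] [h9 h10] [h11 h12]] :=
  AdK_invariant_entries _ qp inv.
have := AdK_invariant_entries _ qp (AdK_invariant_tr _ inv); rewrite !mxE.
move=> [[g1 g2 g3 g4] [g5 g6 g7 g8] _ _].
have e21 : b 2 1 = - b 1 2 by apply/eqP; rewrite -addr_eq0 addrC h10.
have e43 : b 4 3 = - b 3 4 by apply/eqP; rewrite -addr_eq0 addrC h12.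
apply/matrixP => i j; rewrite !mxE.
elim/ord5_ind: i; elim/ord5_ind: j; rewrite /= ?h1 ?h2 ?h3 ?h4 ?h5 ?h6 ?h7 ?h8
  ?g1 ?g2 ?g3 ?g4 ?g5 ?g6 ?g7 ?g8 ?e21 ?e43 -?h9 -?h11; ring.
Qed.

Lemma Dg_invariant (m x y : R) : AdK_invariant p q (Dg m x y).
Proof.
move=> k [z z1 ->] X Y; rewrite !Ad_m_part //.
have w k' : `|z ^+ k'| = 1 by rewrite normrX z1 expr1n.
have hp := normc1_sqr (z ^+ p ^+ 2); have hq := normc1_sqr (z ^+ q ^+ 2).
rewrite !normrX z1 !expr1n in hp hq; have {}hp := hp erefl; have {}hq := hq erefl.
rewrite [in RHS](vec5_eta _ X) [in RHS](vec5_eta _ Y) /rot !bil_Dg.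
move: hp hq; move: (complex.Re _) (complex.Im _) (complex.Re _) (complex.Im _).
move=> C S C' S' h h'.
have e : S ^+ 2 = 1 - C ^+ 2 by lra.
have e' : S' ^+ 2 = 1 - C' ^+ 2 by lra.
ring: e e'.
Qed.

Lemma Dg_inv_metrics (m x y : R) : 0 < m -> 0 < x -> 0 < y ->
  inv_metrics p q (Dg m x y).
Proof.
move=> m0 x0 y0; split; [exact: tr_diag_mx | move=> X | exact: Dg_invariant].
rewrite {1}(vec5_eta _ X) => X0; rewrite (vec5_eta _ X) bil_Dg.
move: (X 0 0) (X 0 1) (X 0 2) (X 0 3) (X 0 4) X0 => a b c d e X0.
have sq (k u : R) : 0 < k -> 0 <= k * u ^+ 2.
  by move=> k0; rewrite mulr_ge0 ?sqr_ge0 // ltW.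
have -> : m * a * a + x * (b * b + c * c) + y * (d * d + e * e) =
  m * a ^+ 2 + x * b ^+ 2 + x * c ^+ 2 + y * d ^+ 2 + y * e ^+ 2 by ring.
rewrite lt0r; apply/andP; split; last by do ![apply: addr_ge0]; apply: sq.
apply: contraNN X0.
rewrite !paddr_eq0; try by do ?[apply: addr_ge0]; apply: sq.
rewrite !mulf_eq0 !(gt_eqF m0, gt_eqF x0, gt_eqF y0) /= ?sqrf_eq0 ?orbb.
move=> /andP[/andP[/andP[/andP[/eqP -> /eqP ->] /eqP ->] /eqP ->] /eqP ->].
by apply/eqP/rowP => i; rewrite [RHS]mxE; elim/ord5_ind: i; rewrite vec5E.
Qed.

Lemma inv_metrics_Dg (g : 'M[R]_5) : (q < p)%N -> inv_metrics p q g ->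
  exists m x y, [/\ g = Dg m x y, 0 < m, 0 < x & 0 < y].
Proof.
move=> qp [gT gpos ginv]; exists (g 0 0), (g 1 1), (g 3 3).
have ev0 i : ev R i != 0.
  apply/eqP => /rowP /(_ i); rewrite ev_coord eqxx mxE => /eqP.
  by rewrite oner_eq0.
split; [|rewrite -bil_ev; exact: gpos..].
rewrite [LHS](AdK_invariant_mx _ qp ginv).
have [_ _ [_ h] [_ h']] := AdK_invariant_entries _ qp ginv.
have s i j : g i j = g j i by rewrite -[in LHS]gT mxE.
have -> : g 1 2 = 0 by rewrite (s 2 1) in h; lra.
have -> : g 3 4 = 0 by rewrite (s 4 3) in h'; lra.
by rewrite !scale0r !addr0.
Qed.

(** Only e^{23} and e^{45} occur in an invariant 2-form. Pairing with [X,Y] then involves only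
    brackets with [e_1], which act on each plane by an area-preserving rotation, and the cyclic sum
    cancels. *)
Lemma d2_invariant (b : 'M[R]_5) : (q < p)%N -> inv_2forms p q b ->
  forall i j k, d2 p q b i j k = 0.
Proof.
move=> qp [bT binv] i j k.
have anti u v : b u v = - b v u.
  by have := congr1 (fun M : 'M[R]_5 => M v u) bT; rewrite !mxE.
have diag0 u : b u u = 0 by have := anti u u; lra.
have form X Y : bil b X Y = b 1 2 * (X 0 1 * Y 0 2 - X 0 2 * Y 0 1)
    + b 3 4 * (X 0 3 * Y 0 4 - X 0 4 * Y 0 3).
  have [[h1 h2 h3 h4] [h5 h6 h7 h8] _ _] := AdK_invariant_entries _ qp binv.
  have z u v : b u v = 0 -> b v u = 0 by rewrite (anti v u) => ->; rewrite oppr0.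
  rewrite bilE sum_ord5 !sum_ord5 !diag0 h1 h2 h3 h4 h5 h6 h7 h8.
  rewrite (z _ _ h1) (z _ _ h2) (z _ _ h3) (z _ _ h4) (z _ _ h5) (z _ _ h6).
  by rewrite (z _ _ h7) (z _ _ h8) (anti 2 1) (anti 4 3); ring.
have bracket X Y Z : bil b (br_m p q X Y) Z =
  b 1 2 * (- (Q * (X 0 0 * Y 0 2 - X 0 2 * Y 0 0)) * Z 0 2 -
    Q * (X 0 0 * Y 0 1 - X 0 1 * Y 0 0) * Z 0 1) +
  b 3 4 * (P * (X 0 0 * Y 0 4 - X 0 4 * Y 0 0) * Z 0 4 +
    P * (X 0 0 * Y 0 3 - X 0 3 * Y 0 0) * Z 0 3).
  by rewrite form !br_m_coord //; ring.
(* The three terms of [d2] are replaced at once by unification with its unfolding, leaving a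
   polynomial identity in coordinates. *)
have alternating (u v w u' v' w' : R) : u = u' -> v = v' -> w = w' ->
  - u' + v' - w' = 0 -> - u + v - w = 0 by move=> -> -> ->.
apply: (alternating _ _ _ _ _ _ (bracket _ _ _) (bracket _ _ _) (bracket _ _ _)).
by move: (ev R i) (ev R j) (ev R k) => X Y Z; ring.
Qed.

Lemma torsion_invariant (b : 'M[R]_5) (H : form3 R) : (q < p)%N ->
  inv_2forms p q b -> torsion p q H b = H.
Proof.
move=> qp binv; apply/funext => i; apply/funext => j; apply/funext => k.
by rewrite /torsion d2_invariant // addr0.
Qed.

Lemma inv_2forms0 : inv_2forms p q (0 : 'M[R]_5).
Proof.
split; first by rewrite trmx0 oppr0.
by move=> k _ X Y; rewrite /bil !mulmx0 !mul0mx.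
Qed.

(** All test forms are closed, so the adjointness condition makes [w] orthogonal to every invariant
    2-form, itself included; the norm is a sum of squares with positive weights. *)
Lemma codiff_eq0 (m x y : R) H w : (q < p)%N -> 0 < m -> 0 < x -> 0 < y ->
  is_codiff p q (Dg m x y) H w <-> w = 0.
Proof.
move=> qp m0 x0 y0.
have ip0 b : inv_2forms p q b -> ip3 (Dg m x y) H (d2 p q b) = 0.
  move=> binv; rewrite /ip3 (_ : d2 p q b = fun _ _ _ => 0); last first.
    by apply/funext => i; apply/funext => j; apply/funext => k; exact: d2_invariant.
  rewrite big1 ?mulr0 // => i _; rewrite big1 // => j _.
  rewrite (_ : iota3 _ j = 0) ?/contract2; last by apply/matrixP => k l; rewrite !mxE.
  by rewrite trmx0 !mulmx0 mxtrace0 mulr0.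
split=> [[winv h]|->]; last first.
  split=> [|b binv]; first exact: inv_2forms0.
  by rewrite ip0 // /ip2 /contract2 mulmx0 !mul0mx mxtrace0 mulr0.
have := h _ winv; rewrite ip0 // /ip2 contract2_Dg // => /eqP.
set d := vec5 _ _ _ _ _.
have d0 i : 0 < d 0 i by elim/ord5_ind: i; rewrite vec5E invr_gt0.
have t0 i j : 0 <= d 0 i * d 0 j * (w i j * w i j).
  by rewrite mulr_ge0 ?sqr_ge0 // mulr_ge0 // ltW.
rewrite mulf_eq0 invr_eq0 pnatr_eq0 /= psumr_eq0; last first.
  by move=> i _; apply: sumr_ge0.
move=> /allP hw; apply/matrixP => i j; have := hw i (mem_index_enum _).
rewrite /= psumr_eq0 // => /allP /(_ j (mem_index_enum _)) /=.
by rewrite !mulf_eq0 !(gt_eqF (d0 _)) /= orbb mxE => /eqP.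
Qed.

Lemma g_oE : g_o R p q = Dg (2 * n) (Q ^+ 2 / n) (P ^+ 2 / n).
Proof. by []. Qed.

End Invariants.

(** * Ordinary differential equations *)

Section RealAnalysis.
Variable R : realType.
Implicit Types (f g df dg : R -> R) (a b t : R).

Lemma deriv_ge0_le f df a b : a <= b -> {within `[a, b], continuous f} ->
  (forall s, s \in `]a, b[ -> is_derive s 1 f (df s)) ->
  (forall s, s \in `]a, b[ -> 0 <= df s) -> f a <= f b.
Proof.
rewrite le_eqVlt => /predU1P[->//|ab] cf dfE df0.
have [c cab h] := MVT ab dfE cf.
by rewrite -subr_ge0 h mulr_ge0 ?df0 // subr_ge0 ltW.
Qed.

Lemma within_continuous_sum f g a b : {within `[a, b], continuous f} ->
  {within `[a, b], continuous g} -> {within `[a, b], continuous (f \+ g)}.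
Proof. by move=> cf cg x; apply: cvgD; [exact: cf | exact: cg]. Qed.

(** Mean value inequality with a majorant function: g + f and g - f are both nondecreasing. *)
Lemma deriv_dominated f df g dg a b : a <= b ->
  {within `[a, b], continuous f} -> {within `[a, b], continuous g} ->
  (forall s, s \in `]a, b[ -> is_derive s 1 f (df s)) ->
  (forall s, s \in `]a, b[ -> is_derive s 1 g (dg s)) ->
  (forall s, s \in `]a, b[ -> `|df s| <= dg s) ->
  `|f b - f a| <= g b - g a.
Proof.
move=> ab cf cg dfE dgE h.
have h1 : (g + f) a <= (g + f) b.
  apply: (@deriv_ge0_le _ (fun s => dg s + df s)) => //.
  - exact: within_continuous_sum.
  - by move=> s sab; apply: is_deriveD; [exact: dgE | exact: dfE].
  - by move=> s sab; have := h s sab; rewrite ler_norml => /andP[? _]; lra.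
have h2 : (g - f) a <= (g - f) b.
  apply: (@deriv_ge0_le _ (fun s => dg s - df s)) => //.
  - by apply: within_continuous_sum => // x; apply: cvgN; exact: cf.
  - by move=> s sab; apply: is_deriveB; [exact: dgE | exact: dfE].
  - by move=> s sab; have := h s sab; rewrite ler_norml => /andP[? ?]; lra.
move: h1 h2; rewrite !fctE /= => h1 h2.
by rewrite ler_norml; apply/andP; split; lra.
Qed.

Lemma is_derive_within_continuous f df a b :
  (forall s, s \in `[a, b] -> is_derive s 1 f (df s)) ->
  {within `[a, b], continuous f}.
Proof.
move=> h; apply: derivable_within_continuous => s sab.
by have [] := h s sab.
Qed.

Lemma lipschitz_continuous f (C : R) :
  (forall s t, `|f s - f t| <= C * `|s - t|) -> continuous f.
Proof.
move=> h x; apply/cvgrPdist_le => e e0.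
have C0 : 0 < `|C| + 1 by rewrite ltr_wpDl.
near=> t.
apply: (le_trans (h _ _)); apply: (@le_trans _ _ ((`|C| + 1) * `|x - t|)).
  by rewrite ler_wpM2r // (le_trans (ler_norm _)) // lerDl.
rewrite -ler_pdivlMl //.
near: t; apply: cvgr_dist_le; first exact: cvg_id.
by rewrite mulr_gt0 // invr_gt0.
Unshelve. all: by end_near.
Qed.

Lemma maxr_lipschitz (s t c : R) :
  `|Num.max s c - Num.max t c| <= `|s - t|.
Proof.
have h := ler_norm (s - t); have := ler_norm (t - s).
rewrite [`|t - s|]distrC ler_norml => h'.
by rewrite /Num.max; apply/andP; split; case: ltP => ?; case: ltP => ?; lra.
Qed.

(** Places a coordinate near its equilibrium value 2c in the side [c, 4c] of the box used for
    stability. *)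
Lemma dist_double_le (u c d : R) : `|u - 2 * c| <= d -> d <= c -> c <= u <= 4 * c.
Proof. by rewrite ler_norml => /andP[? ?] ?; apply/andP; split; lra. Qed.

(** Both integrals start at [t0 - 1], which makes [t0] an interior point: the derivative there is
    two-sided. *)
Definition primitive_from t0 f (t : R) : R :=
  \int[lebesgue_measure]_(s in `[t0 - 1, t]) f s
  - \int[lebesgue_measure]_(s in `[t0 - 1, t0]) f s.

Lemma primitive_from_self t0 f : primitive_from t0 f t0 = 0.
Proof. exact: subrr. Qed.

Lemma is_derive_primitive_from t0 f t : continuous f -> t0 <= t ->
  is_derive t 1 (primitive_from t0 f) (f t).
Proof.
move=> cf tt; have tu : t < t + 1 by lra.
have int : (lebesgue_measure : measure _ R).-integrable `[t0 - 1, t + 1] (EFin \o f).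
  apply: continuous_compact_integrable; first exact: segment_compact.
  exact: continuous_subspaceT.
have at0 : t0 - 1 < t by lra.
have [d1 d2] := continuous_FTC1_closed tu int at0 (cf t).
rewrite -[f t]subr0 /primitive_from; set I := fun y => _ in d1 d2.
have e : 'D_1 I t = f t by rewrite -derive1E; exact: d2.
have dI := DeriveDef d1 e.
exact: (is_deriveB dI (is_derive_cst (I t0) t 1)).
Qed.

(** The intervals of centre [u k] and radius 2c/2^k are nested; the supremum of their left ends lies
    in all of them, which gives the limit together with its rate. *)
Lemma geometric_cauchy_limit (u : nat -> R) (c : R) :
  (forall k, `|u k.+1 - u k| <= c / 2 ^+ k) ->
  exists l, forall k, `|l - u k| <= 2 * c / 2 ^+ k.
Proof.
move=> h.
pose d k := 2 * c / 2 ^+ k.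
have dS k : d k.+1 = d k - c / 2 ^+ k.
  by rewrite /d exprS; field; rewrite expf_neq0.
have c0 : 0 <= c by have := h 0%N; rewrite expr0 divr1; apply: le_trans.
have d0 k : 0 <= d k by rewrite /d divr_ge0 ?mulr_ge0 ?exprn_ge0.
have lo k : u k - d k <= u k.+1 - d k.+1.
  by rewrite dS; have := h k; rewrite ler_norml => /andP[? ?]; lra.
have hi k : u k.+1 + d k.+1 <= u k + d k.
  by rewrite dS; have := h k; rewrite ler_norml => /andP[? ?]; lra.
have lom j k : (j <= k)%N -> u j - d j <= u k - d k.
  move=> /subnK <-; elim: (k - j)%N => [//|i IH]; exact: le_trans IH (lo _).
have him j k : (j <= k)%N -> u k + d k <= u j + d j.
  move=> /subnK <-; elim: (k - j)%N => [//|i IH]; exact: le_trans (hi _) IH.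
have lohi j k : u j - d j <= u k + d k.
  have := lom _ _ (leq_maxl j k); have := him _ _ (leq_maxr j k).
  by have := d0 (maxn j k); lra.
pose A : set R := range (fun k => u k - d k).
have A0 : A !=set0 by exists (u 0%N - d 0%N); exists 0%N.
have ub k : ubound A (u k + d k) by move=> _ [j _ <-]; exact: lohi.
exists (sup A) => k; rewrite ler_norml -/(d k); apply/andP; split.
  have : u k - d k <= sup A.
    by apply: ub_le_sup; [exists (u 0%N + d 0%N); exact: ub | exists k].
  by lra.
have : sup A <= u k + d k by apply: ge_sup => //; exact: ub.
by lra.
Qed.

End RealAnalysis.
Arguments primitive_from {R}.

(** * Global existence for bounded Lipschitz fields *)

Section Picard.
Variables (R : realType) (n : nat) (F : ('I_n -> R) -> 'I_n -> R) (L M : R).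
Hypothesis L0 : 0 < L.
Hypothesis F_bounded : forall z i, `|F z i| <= M.
Hypothesis F_lipschitz : forall z w (e : R),
  (forall j, `|z j - w j| <= e) -> forall i, `|F z i - F w i| <= L * e.
Variables (t0 : R) (z0 : 'I_n -> R).

Lemma le_of_geometric (a b c : R) : (forall k, a <= b + c / 2 ^+ k) -> a <= b.
Proof.
move=> h; rewrite leNgt; apply/negP => ba; have e0 : 0 < a - b by rewrite subr_gt0.
have c0 : 0 < c by have := h 0%N; rewrite expr0 divr1; lra.
pose k := (Num.truncn (c / (a - b))).+1.
have ck : c / (a - b) < k%:R by apply: truncnS_gt.
have k2 : k%:R < 2 ^+ k :> R by rewrite -natrX ltr_nat ltn_expl.
have := h k; have : c / 2 ^+ k < a - b.
  rewrite ltr_pdivrMr ?exprn_gt0 // mulrC -ltr_pdivrMr //; exact: lt_trans k2.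
lra.
Qed.

Lemma is_derive_exp_shift (a k t : R) :
  is_derive t 1 (fun s => a * expR (k * (s - t0))) (a * k * expR (k * (t - t0))).
Proof.
have d1 : is_derive t 1 (fun s => k * (s - t0)) k.
  have d := is_deriveZ k (is_deriveB (is_derive_id t 1) (is_derive_cst t0 t 1)).
  by apply: is_derive_eq d _; rewrite subr0 /GRing.scale /= mulr1.
have d2 : is_derive t 1 (fun s => expR (k * (s - t0))) (k * expR (k * (t - t0))).
  have d := is_derive1_comp (is_derive_expR _) d1.
  by apply: is_derive_eq d _; rewrite mulrC.
have d := is_deriveZ a d2.
by apply: is_derive_eq d _; rewrite /GRing.scale /= mulrA.
Qed.

(** The Picard operator, frozen at its initial value [z0] before [t0]. Iterates are then Lipschitz
    on the whole line, so the integrands are continuous everywhere, as [is_derive_primitive_from]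
    requires. *)
Let step (y : R -> 'I_n -> R) (t : R) (i : 'I_n) : R :=
  z0 i + primitive_from t0 (fun s => F (y s) i) (Num.max t t0).

Let field_continuous (y : R -> 'I_n -> R) (C : R) :
  (forall s t i, `|y s i - y t i| <= C * `|s - t|) ->
  forall i, continuous (fun s => F (y s) i).
Proof.
move=> h i; apply: (@lipschitz_continuous _ _ (L * C)) => s t.
by rewrite -mulrA; apply: F_lipschitz => j; exact: h.
Qed.

Let step_lipschitz (y : R -> 'I_n -> R) : (forall i, continuous (fun s => F (y s) i)) ->
  forall s t i, `|step y s i - step y t i| <= M * `|s - t|.
Proof.
move=> cF s t i; wlog st : s t / t <= s.
  move=> h; have [|/ltW] := leP t s; first exact: h.
  by rewrite distrC [`|s - t|]distrC; exact: h.
have M0 : 0 <= M by exact: le_trans (normr_ge0 _) (F_bounded z0 i).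
rewrite /step opprD addrACA subrr add0r.
have mm : Num.max t t0 <= Num.max s t0 by rewrite /Num.max; case: ltP => ?; case: ltP => ?; lra.
have tm : t0 <= Num.max t t0 by rewrite le_max lexx orbT.
apply: (@le_trans _ _ (M * Num.max s t0 - M * Num.max t t0)).
  apply: (@deriv_dominated _ _ (fun s => F (y s) i) (fun s => M * s) (fun=> M)) => //.
  - apply: (@is_derive_within_continuous _ _ (fun s => F (y s) i)) => u.
    rewrite in_itv /= => /andP[u1 _]; apply: is_derive_primitive_from => //.
    exact: le_trans u1.
  - by apply: continuous_subspaceT => u; apply: cvgM; [exact: cvg_cst|exact: cvg_id].
  - move=> u; rewrite in_itv /= => /andP[u1 _].
    by apply: is_derive_primitive_from => //; apply: ltW; exact: le_lt_trans u1.
  - move=> u _; have d := is_deriveZ M (is_derive_id u 1).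
    by apply: is_derive_eq d _; rewrite /GRing.scale /= mulr1.
rewrite -mulrBr ler_wpM2l // ger0_norm ?subr_ge0 //.
by rewrite /Num.max; case: ltP => ?; case: ltP => ?; lra.
Qed.

(** Bielecki's weight: integrating L times it gains a factor 1/2, so the Picard operator is a
    contraction on the entire half-line and no short time steps have to be glued. *)
Let growth (t : R) := expR (2 * L * (t - t0)).

Let step_gap (y w : R -> 'I_n -> R) (c : R) :
  (forall i, continuous (fun s => F (y s) i)) ->
  (forall i, continuous (fun s => F (w s) i)) ->
  (forall s i, t0 <= s -> `|y s i - w s i| <= c * growth s) ->
  forall t i, t0 <= t -> `|step y t i - step w t i| <= c / 2 * growth t.
Proof.
move=> cy cw h t i tt; rewrite /step opprD addrACA subrr add0r.
rewrite (max_idPl tt); pose f := primitive_from t0 (fun s => F (y s) i)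
  - primitive_from t0 (fun s => F (w s) i).
have f0 : f t0 = 0 by rewrite /f !fctE !primitive_from_self subrr.
have c0 : 0 <= c.
  have := h t0 i (lexx _); rewrite /growth subrr mulr0 expR0 mulr1.
  exact: le_trans.
have fE s : t0 <= s -> is_derive s 1 f (F (y s) i - F (w s) i).
  by move=> ts; apply: is_deriveB; exact: is_derive_primitive_from.
have : `|f t - f t0| <= c / 2 * growth t - c / 2 * growth t0.
  apply: (@deriv_dominated _ _ (fun s => F (y s) i - F (w s) i)
    (fun s => c / 2 * growth s) (fun s => c / 2 * (2 * L) * growth s)) => //.
  - apply: (@is_derive_within_continuous _ _ (fun s => F (y s) i - F (w s) i)) => u.
    by rewrite in_itv /= => /andP[u1 _]; exact: fE.
  - apply: (@is_derive_within_continuous _ _ (fun s => c / 2 * (2 * L) * growth s)) => u _.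
    exact: is_derive_exp_shift.
  - by move=> u; rewrite in_itv /= => /andP[/ltW u1 _]; exact: fE.
  - by move=> u _; exact: is_derive_exp_shift.
  - move=> u; rewrite in_itv /= => /andP[/ltW u1 _].
    rewrite (_ : _ * growth u = L * (c * growth u)); last by field.
    by apply: F_lipschitz => j; exact: h.
rewrite f0 subr0 => /le_trans; apply; rewrite gerBl mulr_ge0 //.
  by rewrite divr_ge0.
exact: expR_ge0.
Qed.

Let picard k : R -> 'I_n -> R := iter k step (fun _ => z0).

Let picard_continuous k i : continuous (fun s => F (picard k s) i).
Proof.
elim: k i => [|k IH] i.
  by apply: (@lipschitz_continuous _ _ 0) => s t; rewrite subrr normr0 mul0r.
exact: field_continuous _ _ (step_lipschitz _ IH) i.
Qed.

(** Makes the first gap, at most M (t - t0), smaller than [c0 * growth t], since 1 + u <= exp u. *)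
Let c0 := M / (2 * L).

Let picard_gap k t i : t0 <= t ->
  `|picard k.+1 t i - picard k t i| <= c0 * growth t / 2 ^+ k.
Proof.
elim: k t i => [|k IH] t i tt; last first.
  have -> : c0 * growth t / 2 ^+ k.+1 = c0 / 2 ^+ k / 2 * growth t.
    by rewrite exprS; field; rewrite expf_neq0 ?pnatr_eq0 // lt0r_neq0.
  apply: (step_gap (picard k.+1) (picard k) _ (picard_continuous k.+1)
    (picard_continuous k)) => // s j ts.
  by rewrite mulrAC; exact: IH.
have M0 : 0 <= M by exact: le_trans (normr_ge0 _) (F_bounded z0 i).
rewrite expr0 divr1.
have h := step_lipschitz (fun=> z0) (fun i => picard_continuous 0 i) t t0 i.
have e : step (fun=> z0) t0 i = z0 i.
  by rewrite /step maxxx primitive_from_self addr0.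
rewrite e in h; apply: (le_trans h); rewrite ger0_norm ?subr_ge0 //.
have := expR_ge1Dx (2 * L * (t - t0)); rewrite -/(growth t) => g1.
rewrite (_ : M * _ = c0 * (2 * L * (t - t0))).
  by rewrite ler_wpM2l ?divr_ge0 ?mulr_ge0 //; [exact: ltW | lra].
by rewrite /c0; field; exact: lt0r_neq0.
Qed.

Theorem picard_lindelof_global : exists Y : 'I_n -> R -> R, forall i,
  Y i t0 = z0 i /\
  forall t, t0 <= t -> is_derive t 1 (Y i) (F (fun j => Y j t) i).
Proof.
have lim t i : exists l, forall k,
    `|l - picard k (Num.max t t0) i| <= 2 * (c0 * growth (Num.max t t0)) / 2 ^+ k.
  apply: geometric_cauchy_limit => k; apply: picard_gap.
  by rewrite le_max lexx orbT.
pose y t i := sval (cid (lim t i)).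
have yP t i k : `|y t i - picard k (Num.max t t0) i| <=
    2 * (c0 * growth (Num.max t t0)) / 2 ^+ k.
  exact: (svalP (cid (lim t i))).
(* The Lipschitz constant [M] of the iterates survives the limit; it provides the continuity of
   [F (y s) i] needed for the integral equation. *)
have y_lipschitz s t i : `|y s i - y t i| <= M * `|s - t|.
  pose cs := 2 * (c0 * growth (Num.max s t0)).
  pose ct := 2 * (c0 * growth (Num.max t t0)).
  apply: (@le_of_geometric _ _ (cs / 2 + ct / 2)) => k.
  have hs := yP s i k.+1; have ht := yP t i k.+1.
  have h := step_lipschitz _ (picard_continuous k) (Num.max s t0) (Num.max t t0) i.
  have M0 : 0 <= M by exact: le_trans (normr_ge0 _) (F_bounded z0 i).
  have hm : M * `|Num.max s t0 - Num.max t t0| <= M * `|s - t|.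
    by rewrite ler_wpM2l // maxr_lipschitz.
  move: hs ht h hm; rewrite -/cs -/ct exprS !invfM.
  rewrite /picard !iterS -/(picard k) !mulrA => hs ht h hm.
  rewrite ler_norml; move: hs ht h; rewrite !ler_norml.
  move=> /andP[? ?] /andP[? ?] /andP[? ?]; apply/andP; split; lra.
have cF := field_continuous _ _ y_lipschitz.
have yE t i : t0 <= t -> y t i = step y t i.
  move=> tt; apply/eqP; rewrite -subr_eq0 -normr_le0.
  apply: (@le_of_geometric _ _ (2 * (c0 * growth t))) => k; rewrite add0r.
  have h := yP t i k.+1; rewrite (max_idPl tt) in h.
  have := step_gap y (picard k) (2 * c0 / 2 ^+ k) cF (picard_continuous k).
  have hk s j : t0 <= s -> `|y s j - picard k s j| <= 2 * c0 / 2 ^+ k * growth s.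
    move=> ts; have := yP s j k; rewrite (max_idPl ts) => /le_trans; apply.
    by rewrite mulrA mulrAC.
  move=> /(_ hk t i tt) h2; rewrite distrC in h2.
  apply: le_trans (ler_distD (step (picard k) t i) _ _) _.
  apply: le_trans (lerD h h2) _; rewrite le_eqVlt; apply/orP; left; apply/eqP.
  by rewrite exprS; field; rewrite expf_neq0.
(* The integral formula is used without the truncation at [t0], so this function is differentiable
   from both sides at [t0]. *)
exists (fun i t => z0 i + primitive_from t0 (fun s => F (y s) i) t) => i.
split=> [|t tt]; first by rewrite primitive_from_self addr0.
have -> : (fun j => z0 j + primitive_from t0 (fun s => F (y s) j) t) = y t.
  by apply/funext => j; rewrite yE // /step (max_idPl tt).
have d := is_deriveD (is_derive_cst (z0 i) t 1) (is_derive_primitive_from _ t0 _ t (cF i) tt).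
by apply: is_derive_eq d _; rewrite add0r.
Qed.

End Picard.

(** * One-sided derivatives, barriers and Gronwall's inequality *)

Section DerivativeWithin.
Variable R : realType.

Lemma derivative_withinP (V : normedModType R) (J : set R) (y : R -> V) (t : R)
    (v : V) :
  derivative_within J y t v <->
  forall e, 0 < e -> exists2 d, 0 < d & forall s, J s -> s != t ->
    `|s - t| < d -> `|v - (s - t)^-1 *: (y s - y t)| <= e.
Proof.
rewrite /derivative_within; split=> [/cvgrPdist_le h e /h|h].
  rewrite /within /= => /nbhs_ballP[d /= d0 H]; exists d => // s Js st sd.
  by apply: H => //=; [rewrite /ball /= distrC | split=> //; apply/eqP].
apply/cvgrPdist_le => e /h[d d0 H]; apply/nbhs_ballP; exists d => //= s.
by rewrite /ball /= distrC => sd [Js /eqP st]; exact: H.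
Qed.

(** Has the same epsilon-delta shape as [derivative_withinP], so the two notions are compared at
    interior points by shrinking the radius. *)
Lemma is_deriveP (f : R -> R) (t v : R) :
  is_derive t 1 f v <->
  forall e, 0 < e -> exists2 d, 0 < d & forall s, s != t ->
    `|s - t| < d -> `|v - (s - t)^-1 * (f s - f t)| <= e.
Proof.
have -> : is_derive t 1 f v <-> h^-1 *: (f (h *: 1 + t) - f t) @[h --> 0^'] --> v.
  split=> [[d <-]|h]; first exact: d.
  by apply: DeriveDef; [apply/cvg_ex; exists v | exact: cvg_lim].
split=> [/cvgrPdist_le h e /h|h].
  rewrite /dnbhs /within /= => /nbhs_ballP[d /= d0 H]; exists d => // s st sd.
  have := H (s - t); rewrite /ball /= sub0r normrN => /(_ sd).
  by rewrite subr_eq0 => /(_ st); rewrite /GRing.scale /= mulr1 subrK.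
apply/cvgrPdist_le => e /h[d d0 H]; apply/nbhs_ballP; exists d => //= s.
rewrite /ball /= sub0r normrN => sd s0.
have := H (s + t); rewrite addrK -subr_eq0 addrK => /(_ s0 sd).
by rewrite /GRing.scale /= mulr1.
Qed.

Lemma is_derive_quadratic_error (f : R -> R) (t v C : R) :
  (forall s, `|f s - f t - v * (s - t)| <= C * (s - t) ^+ 2) ->
  is_derive t 1 f v.
Proof.
move=> h; apply/is_deriveP => e e0.
have C0 : 0 < `|C| + 1 by rewrite ltr_wpDl.
exists (e / (`|C| + 1)) => [|s st sd]; first by rewrite divr_gt0.
have st0 : 0 < `|s - t| by rewrite normr_gt0 subr_eq0.
rewrite -(ler_pM2l st0) -normrM mulrBr mulrA mulfV ?mul1r ?subr_eq0 // distrC.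
rewrite [(s - t) * v]mulrC; apply: (le_trans (h s)).
rewrite -(real_normK (num_real (s - t))) expr2 mulrCA ler_wpM2l //.
apply: (@le_trans _ _ ((`|C| + 1) * `|s - t|)).
  by rewrite ler_wpM2r // (le_trans (ler_norm _)) // lerDl.
by rewrite mulrC -ler_pdivlMr //; exact: ltW.
Qed.

Lemma mx_norm_le m n (A : 'M[R]_(m, n)) (e : R) : 0 <= e ->
  `|A| <= e <-> forall i j, `|A i j| <= e.
Proof.
move=> e0; rewrite [`|A|]/Num.Def.normr/= mx_normrE; split=> [h i j|h].
  apply: le_trans h; apply/bigmax_geP; right => /=.
  by exists (i, j).
by apply: bigmax_le => // -[i j] _; exact: h.
Qed.

Lemma derivative_within_mx m n (J : set R) (y : R -> 'M[R]_(m, n)) t v :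
  derivative_within J y t v <->
  forall i j, derivative_within J (fun s => y s i j : R^o) t (v i j).
Proof.
have entry s i j : (v - (s - t)^-1 *: (y s - y t)) i j =
    v i j - (s - t)^-1 *: (y s i j - y t i j : R^o) by rewrite !mxE.
split=> [/cvgrPdist_le h i j|h]; apply/cvgrPdist_le => e e0.
  by apply: filterS (h e e0) => s /mx_norm_le; rewrite ltW // => /(_ erefl i j);
    rewrite entry.
have : \forall s \near within (J `\ t) (nbhs t), forall i j,
    `|v i j - (s - t)^-1 *: (y s i j - y t i j : R^o)| <= e.
  apply: filter_forall => i; apply: filter_forall => j.
  by move/cvgrPdist_le : (h i j); apply.
apply: filterS => s hs; apply/mx_norm_le; first exact: ltW.
by move=> i j; rewrite entry.
Qed.

Lemma derivative_within_cvg (J : set R) (f : R -> R) t v :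
  derivative_within J (f : R -> R^o) t v -> f s @[s --> within J (nbhs t)] --> f t.
Proof.
move=> /derivative_withinP /(_ 1 ltr01)[d d0 H]; apply/cvgrPdist_le => e e0.
apply/nbhs_ballP; have c0 : 0 < `|v| + 1 by rewrite ltr_wpDl.
exists (Num.min d (e / (`|v| + 1))) => /=; first by rewrite lt_min d0 divr_gt0.
move=> s; rewrite /ball /= lt_min => /andP[sd se] Js.
have [->|st] := eqVneq s t; first by rewrite subrr normr0 ltW.
have st0 : 0 < `|s - t| by rewrite normr_gt0 subr_eq0.
rewrite distrC in sd se; have := H s Js st sd; rewrite distrC.
move=> /(le_trans (lerB_normD _ _)) => h.
have : `|(s - t)^-1 *: (f s - f t : R^o)| <= `|v| + 1.
  apply: le_trans (_ : `|(s - t)^-1 *: (f s - f t : R^o) - v| + `|v| <= _).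
    by rewrite -{1}[_ *: _](subrK v) ler_normD.
  by rewrite addrC lerD2l; have := H s Js st sd; rewrite distrC.
rewrite normrM normfV mulrC ler_pdivrMr // distrC => /le_trans; apply.
by rewrite mulrC -ler_pdivlMr // ltW.
Qed.

Lemma derivative_within_continuous (J : set R) (f df : R -> R) a b :
  `[a, b] `<=` J ->
  (forall t, J t -> derivative_within J (f : R -> R^o) t (df t)) ->
  {within `[a, b], continuous f}.
Proof.
move=> abJ h; apply/subspace_continuousP => t abt.
have := derivative_within_cvg _ _ _ _ (h t (abJ t abt)).
by apply: cvg_trans; apply: cvg_app; exact: within_subset.
Qed.

Lemma derivative_within_is_derive (J : set R) (f df : R -> R) a b t :
  `[a, b] `<=` J -> t \in `]a, b[ ->
  (forall t, J t -> derivative_within J (f : R -> R^o) t (df t)) ->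
  is_derive t 1 f (df t).
Proof.
rewrite in_itv /= => abJ /andP[at_ tb] h; apply/is_deriveP => e e0.
have Jt : J t by apply: abJ; rewrite /= in_itv /= !ltW.
have /derivative_withinP /(_ e e0)[d d0 H] := h t Jt.
exists (Num.min d (Num.min (t - a) (b - t))) => [|s st].
  by rewrite !lt_min d0 !subr_gt0 at_ tb.
rewrite !lt_min => /andP[sd /andP[sa sb]]; apply: H => //; apply: abJ.
rewrite /= in_itv /=; move: sa sb; rewrite !ltr_norml => /andP[? ?] /andP[? ?].
by apply/andP; split; lra.
Qed.

Lemma is_derive_derivative_within (J : set R) (f : R -> R) (t v : R) :
  is_derive t 1 f v -> derivative_within J (f : R -> R^o) t v.
Proof.
move=> /is_deriveP h; apply/derivative_withinP => e /h[d d0 H].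
by exists d => // s _; exact: H.
Qed.

Lemma within_continuous_postcomp (f g : R -> R) (A : set R) :
  {within A, continuous f} -> continuous g ->
  {within A, continuous (fun s => g (f s))}.
Proof.
by move=> cf cg x; exact: (@continuous_comp (subspace A) R R f g x (cf x) (cg _)).
Qed.

Lemma within_continuous_opp (f : R -> R) (A : set R) :
  {within A, continuous f} -> {within A, continuous (fun s => - f s)}.
Proof. by move=> cf; apply: within_continuous_postcomp cf _; exact: oppr_continuous. Qed.

Definition pos2 (u : R) : R := Num.max u 0 ^+ 2.

Lemma is_derive_pos2 (u : R) : is_derive u 1 pos2 (2 * Num.max u 0).
Proof.
apply: (@is_derive_quadratic_error _ _ _ 1) => s; rewrite /pos2 mul1r ler_norml.
have su := sqr_ge0 (s - u); have u2 := sqr_ge0 u; have s2 := sqr_ge0 s.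
rewrite /Num.max; case: ltP => hs; case: ltP => hu; rewrite ?expr0n /=.
- by apply/andP; split; lra.
- have : 0 <= u * - s by rewrite mulr_ge0 // oppr_ge0 ltW.
  by move=> ?; apply/andP; split; lra.
- have : 0 <= s * - u by rewrite mulr_ge0 // oppr_ge0 ltW.
  by move=> ?; apply/andP; split; lra.
- by apply/andP; split; lra.
Qed.

(* The square of the positive part is differentiable, so the barrier is an
   instance of the monotonicity criterion. *)
Lemma barrier_le (f df : R -> R) (a b K : R) :
  {within `[a, b], continuous f} ->
  (forall s, s \in `]a, b[ -> is_derive s 1 f (df s)) ->
  f a <= K -> (forall s, s \in `]a, b[ -> K <= f s -> df s <= 0) ->
  forall t, t \in `[a, b] -> f t <= K.
Proof.
move=> cf dfE fa hdf t; rewrite in_itv /= => /andP[at_ tb].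
pose g s := - pos2 (f s - K).
have sub : `[a, t] `<=` `[a, b].
  by apply: subset_itvl; rewrite bnd_simp.
have inab s : s \in `]a, t[ -> s \in `]a, b[.
  by rewrite !in_itv /= => /andP[-> /lt_le_trans]; exact.
have : g a <= g t.
  apply: (@deriv_ge0_le _ _ (fun s => - (2 * Num.max (f s - K) 0 * df s))) => //.
  - apply: (continuous_subspaceW sub); apply: within_continuous_opp.
    apply: (@within_continuous_postcomp (fun s => f s - K)).
      apply: within_continuous_sum => //.
      by apply: continuous_subspaceT => s; exact: cvg_cst.
    move=> u; apply: differentiable_continuous; apply/derivable1_diffP.
    by have [] := is_derive_pos2 u.
  - move=> s /inab sab; apply: is_deriveN.
    have d := is_deriveB (dfE s sab) (is_derive_cst K s 1); rewrite subr0 in d.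
    exact: (is_derive1_comp (is_derive_pos2 _) d).
  - move=> s /inab sab; rewrite oppr_ge0 /Num.max.
    case: ltP => [_|h]; first by rewrite mulr0 mul0r.
    by rewrite mulr_ge0_le0 ?mulr_ge0 ?hdf // -subr_ge0.
have e : Num.max (f a - K) 0 = 0 by apply/max_idPr; rewrite subr_le0.
rewrite /g lerN2 /pos2 e expr0n /= => h.
have : Num.max (f t - K) 0 ^+ 2 == 0 by rewrite eq_le h sqr_ge0.
rewrite sqrf_eq0 => /eqP h0; rewrite -subr_le0 -h0.
by rewrite le_max lexx.
Qed.

Lemma barrier_ge (f df : R -> R) (a b K : R) :
  {within `[a, b], continuous f} ->
  (forall s, s \in `]a, b[ -> is_derive s 1 f (df s)) ->
  K <= f a -> (forall s, s \in `]a, b[ -> f s <= K -> 0 <= df s) ->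
  forall t, t \in `[a, b] -> K <= f t.
Proof.
move=> cf dfE fa hdf t tab; rewrite -lerN2.
apply: (@barrier_le (- f) (fun s => - df s) a b) => //.
- by move=> s; apply: cvgN; exact: cf.
- by move=> s sab; apply: is_deriveN; exact: dfE.
- by rewrite lerN2.
- by move=> s sab; rewrite lerN2 oppr_le0; exact: hdf.
Qed.

(** f(s) exp(-k (s - a)) is nonincreasing, whatever the sign of k: a positive k serves for
    uniqueness, a negative one for the decay of the Lyapunov function. *)
Lemma gronwall (f df : R -> R) (a b k : R) : a <= b ->
  {within `[a, b], continuous f} ->
  (forall s, s \in `]a, b[ -> is_derive s 1 f (df s)) ->
  (forall s, s \in `]a, b[ -> df s <= k * f s) ->
  f b <= f a * expR (k * (b - a)).
Proof.
move=> ab cf dfE hdf.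
pose E s := 1 * expR (- k * (s - a)).
pose dE (s : R) : R := 1 * - k * expR (- k * (s - a)).
have EE (s : R) : is_derive s 1 E (dE s) by exact: is_derive_exp_shift.
have cE : {within `[a, b], continuous E}.
  clear - EE; clearbody E dE.
  exact: (@is_derive_within_continuous R E dE a b (fun s _ => EE s)).
pose h s := - (f s * E s).
have dh (s : R) : s \in `]a, b[ -> is_derive s 1 h (- (f s *: dE s + E s *: df s)).
  by move=> sab; apply: is_deriveN; apply: is_deriveM; exact: dfE.
have ch : {within `[a, b], continuous h}.
  by apply: within_continuous_opp => s; exact: (cvgM (cf s) (cE s)).
have : h a <= h b.
  apply: (@deriv_ge0_le R h (fun s => - (f s *: dE s + E s *: df s))) => // s sab.
  have := hdf s sab; have := expR_gt0 (- k * (s - a)).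
  rewrite /dE /E /GRing.scale /=; move: (expR _) (f s) (df s) => x u v x0 vu.
  by rewrite -subr_ge0 in vu; have := mulr_ge0 (ltW x0) vu; lra.
rewrite /h lerN2 /E subrr mulr0 expR0 !mulr1 !mul1r mulNr expRN.
by rewrite ler_pdivrMr ?expR_gt0.
Qed.

End DerivativeWithin.

(** * The reduced flow *)

Section ReducedFlow.
Variables (R : realType) (al be A : R).
Hypotheses (al0 : 0 < al) (be0 : 0 < be) (A0 : 0 < A).

Definition speed_m (m x y : R) := (A ^+ 2 - m ^+ 2) * (al / x ^+ 2 + be / y ^+ 2).
Definition speed_r (k m x : R) := k / x * (m + A ^+ 2 / m) - 1.

(** Continuity up to the ends and equations in the open interval: this is what derivatives within an
    interval provide and what the mean value theorem consumes. *)
Record trajectory (a b : R) (m x y : R -> R) : Prop := Trajectory {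
  cont_m : {within `[a, b], continuous m};
  cont_x : {within `[a, b], continuous x};
  cont_y : {within `[a, b], continuous y};
  traj_gt0 : forall t, t \in `[a, b] -> [/\ 0 < m t, 0 < x t & 0 < y t];
  deriv_m : forall t, t \in `]a, b[ -> is_derive t 1 m (speed_m (m t) (x t) (y t));
  deriv_x : forall t, t \in `]a, b[ -> is_derive t 1 x (speed_r al (m t) (x t));
  deriv_y : forall t, t \in `]a, b[ -> is_derive t 1 y (speed_r be (m t) (y t)) }.

Lemma conformal_weight_gt0 x y : 0 < x -> 0 < y -> 0 < al / x ^+ 2 + be / y ^+ 2.
Proof. by move=> x0 y0; rewrite addr_gt0 // divr_gt0 // exprn_gt0. Qed.

Lemma speed_m_le0 m x y : A <= m -> 0 < x -> 0 < y -> speed_m m x y <= 0.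
Proof.
move=> Am x0 y0; rewrite mulr_le0_ge0 ?(ltW (conformal_weight_gt0 _ _ _ _)) //.
by rewrite subr_le0 ler_sqr ?nnegrE ?(ltW A0) // (le_trans (ltW A0)).
Qed.

Lemma speed_m_ge0 m x y : 0 < m -> m <= A -> 0 < x -> 0 < y -> 0 <= speed_m m x y.
Proof.
move=> m0 mA x0 y0; rewrite mulr_ge0 ?(ltW (conformal_weight_gt0 _ _ _ _)) //.
by rewrite subr_ge0 ler_sqr ?nnegrE ?(ltW m0) ?(ltW A0).
Qed.

(** The arithmetic-geometric inequality with its remainder: the minimum 2A explains the equilibrium
    value 2kA of a radius, and the remainder is quadratic in m - A. *)
Lemma amgm_excess m : 0 < m -> m + A ^+ 2 / m = 2 * A + (m - A) ^+ 2 / m.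
Proof. by move=> m0; field; rewrite lt0r_neq0. Qed.

Lemma speed_r_le0 k m x W : 0 < k -> 0 < x -> m + A ^+ 2 / m <= W -> k * W <= x ->
  speed_r k m x <= 0.
Proof.
move=> k0 x0 mW kW; rewrite /speed_r subr_le0 mulrAC ler_pdivrMr // mul1r.
by apply: le_trans kW; rewrite ler_wpM2l // ltW.
Qed.

Lemma speed_r_ge0 k m x : 0 < k -> 0 < m -> 0 < x -> x <= 2 * k * A ->
  0 <= speed_r k m x.
Proof.
move=> k0 m0 x0 xk; rewrite /speed_r subr_ge0 mulrAC ler_pdivlMr // mul1r.
rewrite amgm_excess //; apply: (le_trans xk).
rewrite mulrDr [2 * k]mulrC mulrA lerDl mulr_ge0 ?(ltW k0) //.
by rewrite divr_ge0 ?sqr_ge0 ?(ltW m0).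
Qed.

Section Box.
Variables ml mh xl xh yl yh : R.

Definition in_box (m x y : R) :=
  [/\ ml <= m <= mh, xl <= x <= xh & yl <= y <= yh].

(** Conditions for the field to point into the box, or along its faces. For x and y, the lower face
    lies below the least zero 2kA of the speed, and the upper face above k (mh + A^2/ml), which
    bounds all of its zeros. *)
Record good_box : Prop := GoodBox {
  ml_gt0 : 0 < ml; xl_gt0 : 0 < xl; yl_gt0 : 0 < yl;
  ml_le : ml <= A; mh_ge : A <= mh;
  xl_le : xl <= 2 * al * A; xh_ge : al * (mh + A ^+ 2 / ml) <= xh;
  yl_le : yl <= 2 * be * A; yh_ge : be * (mh + A ^+ 2 / ml) <= yh }.

Hypothesis gb : good_box.
Let ml0 := ml_gt0 gb.
Let xl0 := xl_gt0 gb.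
Let yl0 := yl_gt0 gb.

Lemma amgm_box m : ml <= m <= mh -> m + A ^+ 2 / m <= mh + A ^+ 2 / ml.
Proof.
move=> /andP[m1 m2]; have m0 : 0 < m := lt_le_trans ml0 m1.
by rewrite lerD // ler_wpM2l ?sqr_ge0 // lef_pV2.
Qed.

Let mlh : ml <= mh. Proof. exact: le_trans (ml_le gb) (mh_ge gb). Qed.

Let w_ge : 2 * A <= mh + A ^+ 2 / ml.
Proof.
apply: le_trans (amgm_box A _); last by rewrite (ml_le gb) (mh_ge gb).
by rewrite amgm_excess // lerDl divr_ge0 ?sqr_ge0 // ltW.
Qed.

Let xlh : xl <= xh.
Proof.
apply: le_trans (xh_ge gb); apply: le_trans (xl_le gb) _.
by rewrite [2 * al]mulrC -mulrA ler_wpM2l // ltW.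
Qed.

Let ylh : yl <= yh.
Proof.
apply: le_trans (yh_ge gb); apply: le_trans (yl_le gb) _.
by rewrite [2 * be]mulrC -mulrA ler_wpM2l // ltW.
Qed.

Lemma good_box_le : [/\ ml <= mh, xl <= xh & yl <= yh].
Proof. by []. Qed.

(** Each face is a barrier. The range of m is settled before the other two, since the upper barriers
    for x and y rely on it. *)
Lemma trajectory_in_box a b m x y : trajectory a b m x y ->
  in_box (m a) (x a) (y a) ->
  forall t, t \in `[a, b] -> in_box (m t) (x t) (y t).
Proof.
move=> tr [/andP[m1 m2] /andP[x1 x2] /andP[y1 y2]].
have oc t : t \in `]a, b[ -> t \in `[a, b] by exact: subset_itv_oo_cc.
have mb t : t \in `[a, b] -> ml <= m t <= mh.
  move=> tab; apply/andP; split.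
    apply: barrier_ge (cont_m _ _ _ _ _ tr) (deriv_m _ _ _ _ _ tr) m1 _ _ tab.
    move=> s /oc /(traj_gt0 _ _ _ _ _ tr)[ms xs ys] h.
    by apply: speed_m_ge0 => //; exact: le_trans (ml_le gb).
  apply: barrier_le (cont_m _ _ _ _ _ tr) (deriv_m _ _ _ _ _ tr) m2 _ _ tab.
  move=> s /oc /(traj_gt0 _ _ _ _ _ tr)[ms xs ys] h.
  by apply: speed_m_le0 => //; exact: le_trans (mh_ge gb) h.
move=> t tab; split; [exact: mb | apply/andP; split | apply/andP; split].
- apply: barrier_ge (cont_x _ _ _ _ _ tr) (deriv_x _ _ _ _ _ tr) x1 _ _ tab.
  move=> s /oc /(traj_gt0 _ _ _ _ _ tr)[ms xs ys] h.
  by apply: speed_r_ge0 => //; exact: le_trans (xl_le gb).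
- apply: barrier_le (cont_x _ _ _ _ _ tr) (deriv_x _ _ _ _ _ tr) x2 _ _ tab.
  move=> s /oc sab h; have [ms xs ys] := traj_gt0 _ _ _ _ _ tr s sab.
  apply: (speed_r_le0 _ _ _ (mh + A ^+ 2 / ml)) => //.
    exact: amgm_box (mb s sab).
  exact: le_trans (xh_ge gb) h.
- apply: barrier_ge (cont_y _ _ _ _ _ tr) (deriv_y _ _ _ _ _ tr) y1 _ _ tab.
  move=> s /oc /(traj_gt0 _ _ _ _ _ tr)[ms xs ys] h.
  by apply: speed_r_ge0 => //; exact: le_trans (yl_le gb).
- apply: barrier_le (cont_y _ _ _ _ _ tr) (deriv_y _ _ _ _ _ tr) y2 _ _ tab.
  move=> s /oc sab h; have [ms xs ys] := traj_gt0 _ _ _ _ _ tr s sab.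
  apply: (speed_r_le0 _ _ _ (mh + A ^+ 2 / ml)) => //.
    exact: amgm_box (mb s sab).
  exact: le_trans (yh_ge gb) h.
Qed.

Definition lyapunov (K m x y : R) :=
  K * (m - A) ^+ 2 + (x - 2 * al * A) ^+ 2 + (y - 2 * be * A) ^+ 2.

Definition lyapunov_rate (K m x y : R) :=
  K * (2 * (m - A) * speed_m m x y) + 2 * (x - 2 * al * A) * speed_r al m x
  + 2 * (y - 2 * be * A) * speed_r be m y.

(* Completing the square: the forcing of x by m - A costs a multiple of
   (m - A)^2, which a large weight K absorbs. *)
Let speed_r_dissipation k m x rl rh : 0 < k -> ml <= m <= mh -> 0 < rl ->
  rl <= x <= rh ->
  2 * (x - 2 * k * A) * speed_r k m x <=
  - (rh^-1 * (x - 2 * k * A) ^+ 2) + k ^+ 2 * mh ^+ 2 / (rl * ml ^+ 2) * (m - A) ^+ 2.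
Proof.
move=> k0 /andP[m1 m2] rl0 /andP[r1 r2].
have m0 : 0 < m := lt_le_trans ml0 m1; have x0 : 0 < x := lt_le_trans rl0 r1.
have rh0 : 0 < rh := lt_le_trans x0 r2; have mh0 : 0 < mh := lt_le_trans m0 m2.
pose u := x - 2 * k * A; pose v := k * (m - A) ^+ 2 / m.
have -> : 2 * (x - 2 * k * A) * speed_r k m x = x^-1 * (2 * u * (v - u)).
  by rewrite /speed_r amgm_excess // /u /v; field; rewrite !lt0r_neq0.
rewrite -/u; apply: (@le_trans _ _ (x^-1 * (v ^+ 2 - u ^+ 2))).
  rewrite ler_wpM2l ?invr_ge0 ?(ltW x0) // -subr_ge0.
  by rewrite (_ : _ - _ = (u - v) ^+ 2) ?sqr_ge0 //; ring.
rewrite mulrBr addrC; apply: lerD.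
  by rewrite lerN2 ler_wpM2r ?sqr_ge0 // lef_pV2.
have -> : x^-1 * v ^+ 2 = k ^+ 2 * (m - A) ^+ 2 / (x * m ^+ 2) * (m - A) ^+ 2.
  by rewrite /v; field; rewrite !lt0r_neq0.
rewrite ler_wpM2r ?sqr_ge0 //; apply: ler_pM.
- by rewrite mulr_ge0 ?sqr_ge0.
- by rewrite invr_ge0 mulr_ge0 ?sqr_ge0 ?(ltW x0).
- have Ah := mh_ge gb; rewrite ler_wpM2l ?sqr_ge0 //.
  have h1 : 0 <= mh - m + A by have := ltW A0; lra.
  have h2 : 0 <= mh + m - A by have := ltW m0; lra.
  by have := mulr_ge0 h1 h2; lra.
- rewrite lef_pV2 ?posrE ?mulr_gt0 ?exprn_gt0 //.
  apply: ler_pM => //; [exact: ltW | exact: sqr_ge0 |].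
  by rewrite ler_sqr ?nnegrE ?(ltW ml0) ?(ltW m0).
Qed.

Lemma lyapunov_decay : exists K rho : R, [/\ 0 < K, 0 < rho &
  forall m x y, in_box m x y ->
    lyapunov_rate K m x y <= - rho * lyapunov K m x y].
Proof.
have mh0 : 0 < mh := lt_le_trans ml0 mlh.
have xh0 : 0 < xh := lt_le_trans xl0 xlh.
have yh0 : 0 < yh := lt_le_trans yl0 ylh.
(* A lower bound on the box for the factor al/x^2 + be/y^2 that drives m towards A. *)
pose phi := al / xh ^+ 2.
have phi0 : 0 < phi by rewrite divr_gt0 ?exprn_gt0.
pose kx := al ^+ 2 * mh ^+ 2 / (xl * ml ^+ 2).
pose ky := be ^+ 2 * mh ^+ 2 / (yl * ml ^+ 2).
have kx0 : 0 < kx by rewrite !(mulr_gt0, invr_gt0, exprn_gt0).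
have ky0 : 0 < ky by rewrite !(mulr_gt0, invr_gt0, exprn_gt0).
(* The m term of the Lyapunov rate is at most -2 K A phi (m - A)^2. With this K, one half of it
   absorbs the forcing (kx + ky)(m - A)^2 of x and y, and the other half gives decay at rate A
   phi. *)
pose K := (kx + ky) / (A * phi).
have K0 : 0 < K by exact: divr_gt0 (addr_gt0 kx0 ky0) (mulr_gt0 A0 phi0).
have KE : K * (A * phi) = kx + ky by apply: divfK; apply: lt0r_neq0; exact: mulr_gt0.
pose rho := Num.min (A * phi) (Num.min xh^-1 yh^-1).
exists K, rho; split=> //.
  by rewrite !lt_min !invr_gt0 xh0 yh0 mulr_gt0.
move=> m x y [mb xb yb].
have dx := speed_r_dissipation _ _ _ _ _ al0 mb xl0 xb.
have dy := speed_r_dissipation _ _ _ _ _ be0 mb yl0 yb.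
have dm : 2 * (m - A) * speed_m m x y <= - (2 * (A * phi) * (m - A) ^+ 2).
  have [/andP[m1 m2] /andP[x1 x2] /andP[y1 y2]] := And3 mb xb yb.
  have m0 : 0 < m := lt_le_trans ml0 m1; have x0 : 0 < x := lt_le_trans xl0 x1.
  have y0 : 0 < y := lt_le_trans yl0 y1.
  have w : phi <= al / x ^+ 2 + be / y ^+ 2.
    apply: (@le_trans _ _ (al / x ^+ 2)); last by rewrite lerDl divr_ge0 ?sqr_ge0 // ltW.
    rewrite ler_wpM2l ?(ltW al0) // lef_pV2 ?posrE ?exprn_gt0 //.
    by rewrite ler_sqr ?nnegrE ?(ltW x0) ?(ltW xh0).
  have -> : 2 * (m - A) * speed_m m x y =
    - (2 * ((m + A) * (al / x ^+ 2 + be / y ^+ 2)) * (m - A) ^+ 2).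
    by rewrite /speed_m; ring.
  rewrite lerN2 ler_wpM2r ?sqr_ge0 // ler_wpM2l //.
  apply: ler_pM => //; [exact: ltW | exact: ltW | by rewrite lerDr ltW].
have r1 : rho <= A * phi by rewrite ge_min lexx.
have r2 : rho <= xh^-1 by rewrite !ge_min lexx !orbT.
have r3 : rho <= yh^-1 by rewrite !ge_min lexx !orbT.
rewrite /lyapunov_rate /lyapunov.
have h1 : rho * (K * (m - A) ^+ 2) <= (kx + ky) * (m - A) ^+ 2.
  rewrite -KE mulrCA -mulrA ler_wpM2l ?(ltW K0) //.
  by rewrite ler_wpM2r ?sqr_ge0.
have h2 := ler_wpM2r (sqr_ge0 (x - 2 * al * A)) r2.
have h3 := ler_wpM2r (sqr_ge0 (y - 2 * be * A)) r3.
have {}dm : K * (2 * (m - A) * speed_m m x y) <= - (2 * (kx + ky) * (m - A) ^+ 2).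
  by apply: (le_trans (ler_wpM2l (ltW K0) dm)); rewrite -KE; lra.
rewrite -/kx in dx; rewrite -/ky in dy.
by clear -dx dy dm h1 h2 h3; lra.
Qed.

End Box.
End ReducedFlow.

(** * The algebra of bounded Lipschitz functions *)

Section BoundedLipschitz.
Variables (R : realType) (n : nat).
Implicit Types (f g : ('I_n.+1 -> R) -> R).

(** One constant serves both as bound and as Lipschitz constant. The class is stable under sums,
    products and inverses away from 0, so the clamped field is treated by following its expression.
    The index type is nonempty, so that the hypothesis forces 0 <= e. *)
Definition bounded_lipschitz f := exists2 C : R, forall z, `|f z| <= C &
  forall z w e, (forall j, `|z j - w j| <= e) -> `|f z - f w| <= C * e.

Lemma bounded_lipschitz_ext f g : f =1 g -> bounded_lipschitz f ->
  bounded_lipschitz g.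
Proof. by move=> fg [C h1 h2]; exists C => [z|z w e]; rewrite -?fg; auto. Qed.

Lemma bounded_lipschitz_cst (c : R) : bounded_lipschitz (fun=> c).
Proof.
exists `|c| => // z w e h; rewrite subrr normr0 mulr_ge0 //.
exact: le_trans (normr_ge0 _) (h ord0).
Qed.

Lemma bounded_lipschitzD f g : bounded_lipschitz f -> bounded_lipschitz g ->
  bounded_lipschitz (fun z => f z + g z).
Proof.
move=> [C c1 c2] [D d1 d2]; exists (C + D) => [z|z w e h].
  by apply: le_trans (ler_normD _ _) _; rewrite lerD.
rewrite opprD addrACA mulrDl; apply: le_trans (ler_normD _ _) _.
by rewrite lerD ?c2 ?d2.
Qed.

Lemma bounded_lipschitzM f g : bounded_lipschitz f -> bounded_lipschitz g ->
  bounded_lipschitz (fun z => f z * g z).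
Proof.
move=> [C c1 c2] [D d1 d2].
have C0 : 0 <= C := le_trans (normr_ge0 _) (c1 (fun=> 0)).
have D0 : 0 <= D := le_trans (normr_ge0 _) (d1 (fun=> 0)).
exists (2 * (C * D)) => [z|z w e h].
  rewrite normrM; apply: (@le_trans _ _ (C * D)); first by rewrite ler_pM.
  by have := mulr_ge0 C0 D0; lra.
have -> : f z * g z - f w * g w = f z * (g z - g w) + (f z - f w) * g w by ring.
have e0 : 0 <= e := le_trans (normr_ge0 _) (h ord0).
apply: le_trans (ler_normD _ _) _; rewrite !normrM.
have -> : 2 * (C * D) * e = C * (D * e) + C * e * D by ring.
by rewrite lerD // ler_pM ?c2 ?d2.
Qed.

Lemma bounded_lipschitzV f (d : R) : 0 < d -> (forall z, d <= f z) ->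
  bounded_lipschitz f -> bounded_lipschitz (fun z => (f z)^-1).
Proof.
move=> d0 df [C c1 c2]; have f0 z : 0 < f z := lt_le_trans d0 (df z).
have C0 : 0 <= C := le_trans (normr_ge0 _) (c1 (fun=> 0)).
have V z : `|(f z)^-1| <= d^-1 by rewrite gtr0_norm ?invr_gt0 // lef_pV2 ?posrE.
exists (d^-1 + C * (d^-1 * d^-1)) => [z|z w e h].
  by apply: le_trans (V z) _; rewrite lerDl !mulr_ge0 ?invr_ge0 ?(ltW d0).
have e0 : 0 <= e := le_trans (normr_ge0 _) (h ord0).
have -> : (f z)^-1 - (f w)^-1 = - (f z - f w) * ((f z)^-1 * (f w)^-1).
  by field; rewrite !lt0r_neq0.
rewrite normrM normrN normrM mulrDl; apply: ler_wpDl.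
  by rewrite mulr_ge0 ?invr_ge0 ?(ltW d0).
by rewrite [C * _ * e]mulrAC ler_pM ?c2 // ler_pM.
Qed.

Definition clamp (lo hi u : R) := Num.max lo (Num.min u hi).

Lemma clamp_itv lo hi u : lo <= hi -> lo <= clamp lo hi u <= hi.
Proof.
by move=> h; rewrite /clamp le_max lexx /= ge_max h ge_min lexx orbT.
Qed.

Lemma clamp_id lo hi u : lo <= u <= hi -> clamp lo hi u = u.
Proof. by move=> /andP[h1 h2]; rewrite /clamp (min_idPl h2); apply/max_idPr. Qed.

Lemma clamp_ge lo hi u : lo <= hi -> hi <= u -> clamp lo hi u = hi.
Proof. by move=> h h1; rewrite /clamp (min_idPr h1); apply/max_idPr. Qed.

Lemma clamp_le lo hi u : lo <= hi -> u <= lo -> clamp lo hi u = lo.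
Proof. by move=> h h1; apply/max_idPl; rewrite ge_min h1. Qed.

Lemma clamp_lipschitz lo hi u v : lo <= hi ->
  `|clamp lo hi u - clamp lo hi v| <= `|u - v|.
Proof.
move=> h; have h1 := ler_norm (u - v); have := ler_norm (v - u).
rewrite [`|v - u|]distrC => h2; rewrite ler_norml /clamp /Num.max /Num.min.
by apply/andP; split; (case: (ltP u hi) => ?; case: (ltP v hi) => ?;
  case: ltP => ?; case: ltP => ?; lra).
Qed.

Lemma bounded_lipschitz_clamp lo hi (i : 'I_n.+1) : lo <= hi ->
  bounded_lipschitz (fun z => clamp lo hi (z i)).
Proof.
move=> h; exists (`|lo| + `|hi| + 1) => [z|z w e ze].
  have /andP[h1 h2] := clamp_itv lo hi (z i) h.
  have := ler_norm hi; have := ler_norm (- lo); rewrite normrN => ? ?.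
  have := normr_ge0 hi; have := normr_ge0 lo => ? ?.
  by rewrite ler_norml; apply/andP; split; lra.
have e0 : 0 <= e := le_trans (normr_ge0 _) (ze i).
apply: le_trans (clamp_lipschitz _ _ _ _ h) (le_trans (ze i) _).
by rewrite ler_peMl // lerDr addr_ge0.
Qed.

End BoundedLipschitz.
Arguments clamp {R}.

(** * Exponential decay along trajectories *)

Section ReducedFlowSolutions.
Variables (R : realType) (al be A : R).
Hypotheses (al0 : 0 < al) (be0 : 0 < be) (A0 : 0 < A).
Local Notation speed_m := (speed_m R al be A).
Local Notation speed_r := (speed_r R A).
Local Notation trajectory := (trajectory R al be A).
Local Notation good_box := (good_box R al be A).
Local Notation in_box := (in_box R).

Lemma is_derive_sqr_dev (f : R -> R) (t v c : R) : is_derive t 1 f v ->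
  is_derive t 1 (fun s => (f s - c) ^+ 2) (2 * (f t - c) * v).
Proof.
move=> d; have d1 := is_deriveB d (is_derive_cst c t 1).
have d2 := is_deriveM d1 d1.
by apply: is_derive_eq d2 _; rewrite /GRing.scale /= subr0 !fctE; ring.
Qed.

Lemma is_derive_continuous (f df : R -> R) :
  (forall u : R, is_derive u 1 f (df u)) -> continuous f.
Proof.
move=> h u; apply: differentiable_continuous; apply/derivable1_diffP.
by have [] := h u.
Qed.

Lemma within_continuous_sqr_dev (f : R -> R) (D : set R) (c : R) :
  {within D, continuous f} -> {within D, continuous (fun s => (f s - c) ^+ 2)}.
Proof.
have d (u : R) : is_derive u 1 (fun u : R => (u - c) ^+ 2) (2 * (u - c) * 1).
  exact: (is_derive_sqr_dev id u 1 c (is_derive_id u 1)).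
move=> cf; pose g (u : R) : R := (u - c) ^+ 2.
exact: (within_continuous_postcomp R f g D cf (is_derive_continuous g _ d)).
Qed.

(** [K] and [rho] depend on the box only and are chosen before the trajectory; stability rests on
    this uniformity. *)
Lemma trajectory_decay ml mh xl xh yl yh : good_box ml mh xl xh yl yh ->
  exists K rho : R, [/\ 0 < K, 0 < rho &
  forall a b m x y, a <= b -> trajectory a b m x y ->
    in_box ml mh xl xh yl yh (m a) (x a) (y a) ->
    lyapunov R al be A K (m b) (x b) (y b) <=
      lyapunov R al be A K (m a) (x a) (y a) * expR (- rho * (b - a))].
Proof.
move=> gb; have [K [rho [K0 rho0 h]]] := lyapunov_decay _ _ _ _ al0 be0 A0 _ _ _ _ _ _ gb.
exists K, rho; split=> // a b m x y ab tr ib.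
have box := trajectory_in_box _ _ _ _ al0 be0 A0 _ _ _ _ _ _ gb _ _ _ _ _ tr ib.
apply: (@gronwall R (fun t => lyapunov R al be A K (m t) (x t) (y t))
  (fun t => lyapunov_rate R al be A K (m t) (x t) (y t))) => //.
- have cm := within_continuous_sqr_dev _ _ A (cont_m _ _ _ _ _ _ _ _ _ tr).
  have cx := within_continuous_sqr_dev _ _ (2 * al * A) (cont_x _ _ _ _ _ _ _ _ _ tr).
  have cy := within_continuous_sqr_dev _ _ (2 * be * A) (cont_y _ _ _ _ _ _ _ _ _ tr).
  have cK := within_continuous_postcomp R _ (fun u => K * u) _ cm (@mulrl_continuous _ K).
  exact: (within_continuous_sum _ _ _ _ _ (within_continuous_sum _ _ _ _ _ cK cx) cy).
- move=> s sab; apply: is_deriveD; first apply: is_deriveD.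
  + apply: (is_deriveZ K).
    exact: is_derive_sqr_dev (deriv_m _ _ _ _ _ _ _ _ _ tr s sab).
  + exact: is_derive_sqr_dev (deriv_x _ _ _ _ _ _ _ _ _ tr s sab).
  + exact: is_derive_sqr_dev (deriv_y _ _ _ _ _ _ _ _ _ tr s sab).
- by move=> s sab; apply: h; apply: box; exact: subset_itv_oo_cc.
Qed.

End ReducedFlowSolutions.

(** * Existence and uniqueness through the clamped field *)

Section ClampedFlow.
Variables (R : realType) (al be A : R).
Hypotheses (al0 : 0 < al) (be0 : 0 < be) (A0 : 0 < A).
Local Notation speed_m := (speed_m R al be A).
Local Notation speed_r := (speed_r R A).
Local Notation trajectory := (trajectory R al be A).
Local Notation good_box := (good_box R al be A).
Local Notation in_box := (in_box R).
Variables ml mh xl xh yl yh : R.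
Hypothesis gb : good_box ml mh xl xh yl yh.
Let ml0 := ml_gt0 _ _ _ _ _ _ _ _ _ _ gb.
Let xl0 := xl_gt0 _ _ _ _ _ _ _ _ _ _ gb.
Let yl0 := yl_gt0 _ _ _ _ _ _ _ _ _ _ gb.

Let cm (z : 'I_3 -> R) := clamp ml mh (z 0).
Let cx (z : 'I_3 -> R) := clamp xl xh (z 1).
Let cy (z : 'I_3 -> R) := clamp yl yh (z 2).

Definition clamped_field (z : 'I_3 -> R) (i : 'I_3) : R :=
  nth 0 [:: speed_m (cm z) (cx z) (cy z); speed_r al (cm z) (cx z);
            speed_r be (cm z) (cy z)] i.

Lemma ord3_ind (P : 'I_3 -> Prop) : P 0 -> P 1 -> P 2 -> forall i, P i.
Proof.
move=> P0 P1 P2 [[|[|[|//]]] h].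
- by rewrite (_ : Ordinal h = 0) //; apply/val_inj.
- by rewrite (_ : Ordinal h = 1) //; apply/val_inj.
- by rewrite (_ : Ordinal h = 2) //; apply/val_inj.
Qed.

Lemma clamped_field_lipschitz : exists2 C : R, 0 < C &
  (forall z i, `|clamped_field z i| <= C) /\
  forall z w e, (forall j, `|z j - w j| <= e) ->
    forall i, `|clamped_field z i - clamped_field w i| <= C * e.
Proof.
have [mlh xlh ylh] :=
  good_box_le _ _ _ _ al0 be0 A0 _ _ _ _ _ _ gb.
have bm : bounded_lipschitz R 2 cm by exact: bounded_lipschitz_clamp.
have bx : bounded_lipschitz R 2 cx by exact: bounded_lipschitz_clamp.
have by_ : bounded_lipschitz R 2 cy by exact: bounded_lipschitz_clamp.
have mV : bounded_lipschitz R 2 (fun z => (cm z)^-1).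
  apply: (bounded_lipschitzV _ _ _ ml) => // z.
  by have /andP[] := clamp_itv _ ml mh (z 0) mlh.
have xV : bounded_lipschitz R 2 (fun z => (cx z)^-1).
  apply: (bounded_lipschitzV _ _ _ xl) => // z.
  by have /andP[] := clamp_itv _ xl xh (z 1) xlh.
have yV : bounded_lipschitz R 2 (fun z => (cy z)^-1).
  apply: (bounded_lipschitzV _ _ _ yl) => // z.
  by have /andP[] := clamp_itv _ yl yh (z 2) ylh.
have cst c := bounded_lipschitz_cst R 2 c.
have D f g := bounded_lipschitzD R 2 f g.
have M f g := bounded_lipschitzM R 2 f g.
have r k f : bounded_lipschitz R 2 (fun z => (f z)^-1) ->
    bounded_lipschitz R 2 (fun z => speed_r k (cm z) (f z)).
  move=> fV; apply: (D _ _ _ (cst (-1))); apply: (M); first exact: (M).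
  by apply: (D) => //; exact: (M).
have [C1 h1 k1] := r al cx xV; have [C2 h2 k2] := r be cy yV.
have : bounded_lipschitz R 2 (fun z => speed_m (cm z) (cx z) (cy z)).
  apply: (bounded_lipschitz_ext _ _ (fun z => (A ^+ 2 + - 1 * (cm z * cm z)) *
    (al * ((cx z)^-1 * (cx z)^-1) + be * ((cy z)^-1 * (cy z)^-1)))).
    by move=> z; rewrite /speed_m -!invfM !expr2 mulN1r.
  apply: (M); apply: (D) => //; apply: (M) => //; exact: (M).
move=> [C0 h0 k0].
have C00 : 0 <= C0 := le_trans (normr_ge0 _) (h0 (fun=> 0)).
have C10 : 0 <= C1 := le_trans (normr_ge0 _) (h1 (fun=> 0)).
have C20 : 0 <= C2 := le_trans (normr_ge0 _) (h2 (fun=> 0)).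
exists (C0 + C1 + C2 + 1); first by lra.
split=> [z i|z w e h i].
  by elim/ord3_ind: i; rewrite /clamped_field /=;
    [have := h0 z|have := h1 z|have := h2 z]; lra.
have e0 : 0 <= e := le_trans (normr_ge0 _) (h 0).
have := mulr_ge0 C00 e0; have := mulr_ge0 C10 e0; have := mulr_ge0 C20 e0.
by elim/ord3_ind: i; rewrite /clamped_field /=;
  [have := k0 _ _ _ h|have := k1 _ _ _ h|have := k2 _ _ _ h]; lra.
Qed.

Let vec3 (m x y : R) (i : 'I_3) := nth 0 [:: m; x; y] i.

Lemma clamped_field_box m x y : in_box ml mh xl xh yl yh m x y ->
  [/\ clamped_field (vec3 m x y) 0 = speed_m m x y,
      clamped_field (vec3 m x y) 1 = speed_r al m x &
      clamped_field (vec3 m x y) 2 = speed_r be m y].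
Proof.
by move=> [mb xb yb]; rewrite /clamped_field /cm /cx /cy /= !clamp_id.
Qed.

(** Both trajectories stay in the box, where the field agrees with its clamped version and so is
    Lipschitz; Gronwall's inequality applies to their squared distance. *)
Lemma trajectory_unique a b m x y m' x' y' : a <= b ->
  trajectory a b m x y -> trajectory a b m' x' y' ->
  in_box ml mh xl xh yl yh (m a) (x a) (y a) ->
  m' a = m a -> x' a = x a -> y' a = y a ->
  [/\ m' b = m b, x' b = x b & y' b = y b].
Proof.
move=> ab tr tr' ib em ex ey.
have box := trajectory_in_box _ _ _ _ al0 be0 A0 _ _ _ _ _ _ gb _ _ _ _ _ tr ib.
have box' : forall t, t \in `[a, b] -> in_box ml mh xl xh yl yh (m' t) (x' t) (y' t).
  by apply: (trajectory_in_box _ _ _ _ al0 be0 A0 _ _ _ _ _ _ gb _ _ _ _ _ tr');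
    rewrite em ex ey.
have [C C0 [_ lip]] := clamped_field_lipschitz.
pose dm := m - m'; pose dx := x - x'; pose dy := y - y'.
pose D t := (dm t - 0) ^+ 2 + (dx t - 0) ^+ 2 + (dy t - 0) ^+ 2.
pose vm t := speed_m (m t) (x t) (y t) - speed_m (m' t) (x' t) (y' t).
pose vx t := speed_r al (m t) (x t) - speed_r al (m' t) (x' t).
pose vy t := speed_r be (m t) (y t) - speed_r be (m' t) (y' t).
have cB f g : {within `[a, b], continuous f} -> {within `[a, b], continuous g} ->
    {within `[a, b], continuous (f - g : R -> R)}.
  by move=> cf cg t; exact: (cvgB (cf t) (cg t)).
(* With e the sum of the three distances, each term is at most 2C e times one of them; the total is
   at most 2C e^2, and e^2 <= 3D gives 6C. *)
have : D b <= D a * expR (6 * C * (b - a)).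
  apply: (@gronwall R D (fun t => 2 * (dm t - 0) * vm t + 2 * (dx t - 0) * vx t
    + 2 * (dy t - 0) * vy t)) => //.
  - have c1 := within_continuous_sqr_dev _ dm `[a, b] 0
      (cB _ _ (cont_m _ _ _ _ _ _ _ _ _ tr) (cont_m _ _ _ _ _ _ _ _ _ tr')).
    have c2 := within_continuous_sqr_dev _ dx `[a, b] 0
      (cB _ _ (cont_x _ _ _ _ _ _ _ _ _ tr) (cont_x _ _ _ _ _ _ _ _ _ tr')).
    have c3 := within_continuous_sqr_dev _ dy `[a, b] 0
      (cB _ _ (cont_y _ _ _ _ _ _ _ _ _ tr) (cont_y _ _ _ _ _ _ _ _ _ tr')).
    exact: (within_continuous_sum _ _ _ _ _ (within_continuous_sum _ _ _ _ _ c1 c2) c3).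
  - move=> s sab; apply: is_deriveD; first apply: is_deriveD.
    + apply: is_derive_sqr_dev; apply: is_deriveB.
        exact: deriv_m _ _ _ _ _ _ _ _ _ tr s sab.
      exact: deriv_m _ _ _ _ _ _ _ _ _ tr' s sab.
    + apply: is_derive_sqr_dev; apply: is_deriveB.
        exact: deriv_x _ _ _ _ _ _ _ _ _ tr s sab.
      exact: deriv_x _ _ _ _ _ _ _ _ _ tr' s sab.
    + apply: is_derive_sqr_dev; apply: is_deriveB.
        exact: deriv_y _ _ _ _ _ _ _ _ _ tr s sab.
      exact: deriv_y _ _ _ _ _ _ _ _ _ tr' s sab.
  - move=> s /subset_itv_oo_cc sab.
    have [e1 e2 e3] := clamped_field_box _ _ _ (box s sab).
    have [e1' e2' e3'] := clamped_field_box _ _ _ (box' s sab).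
    pose e := `|dm s| + `|dx s| + `|dy s|.
    have he j : `|vec3 (m s) (x s) (y s) j - vec3 (m' s) (x' s) (y' s) j| <= e.
      have := normr_ge0 (dm s); have := normr_ge0 (dx s); have := normr_ge0 (dy s).
      elim/ord3_ind: j; rewrite /vec3 /= /e -/(dm s) -/(dx s) -/(dy s).
      + by rewrite (_ : m s - m' s = dm s) //; lra.
      + by rewrite (_ : x s - x' s = dx s) //; lra.
      + by rewrite (_ : y s - y' s = dy s) //; lra.
    have h1 := lip _ _ _ he 0; rewrite e1 e1' -/(vm s) in h1.
    have h2 := lip _ _ _ he 1; rewrite e2 e2' -/(vx s) in h2.
    have h3 := lip _ _ _ he 2; rewrite e3 e3' -/(vy s) in h3.
    have bound u v : `|v| <= C * e -> 2 * u * v <= 2 * C * (`|u| * e).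
      move=> hv; apply: le_trans (ler_norm _) _; rewrite -mulrA !normrM.
      rewrite ger0_norm // -mulrA ler_wpM2l // mulrCA.
      exact: ler_wpM2l.
    rewrite /D !subr0.
    have := lerD (lerD (bound (dm s) _ h1) (bound (dx s) _ h2)) (bound (dy s) _ h3).
    move=> /le_trans; apply; rewrite -!mulrDr -!mulrDl -/e.
    rewrite (_ : 6 * C = 2 * C * 3); last by ring.
    rewrite -mulrA ler_wpM2l ?mulr_ge0 ?(ltW C0) //.
    rewrite -[dm s ^+ 2]real_normK ?num_real // -[dx s ^+ 2]real_normK ?num_real //.
    rewrite -[dy s ^+ 2]real_normK ?num_real // /e.
    move: `|dm s| `|dx s| `|dy s| => u v w.
    by have := sqr_ge0 (u - v); have := sqr_ge0 (u - w); have := sqr_ge0 (v - w); lra.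
have sub0 u v : u = v -> u - v = 0 :> R by move->; rewrite subrr.
have Da : D a = 0.
  by rewrite /D /dm /dx /dy !fctE !subr0 em ex ey !subrr expr0n !addr0.
rewrite Da mul0r /D !subr0 => Db.
have [s1 s2 s3] := And3 (sqr_ge0 (dm b)) (sqr_ge0 (dx b)) (sqr_ge0 (dy b)).
have z (u : R) : u ^+ 2 = 0 -> u = 0 by move=> /eqP; rewrite sqrf_eq0 => /eqP.
have z1 : dm b = 0 by apply: z; lra.
have z2 : dx b = 0 by apply: z; lra.
have z3 : dy b = 0 by apply: z; lra.
by split; apply/esym/eqP; rewrite -subr_eq0; apply/eqP.
Qed.

(** Once a coordinate of a solution of the clamped field passes a face, its clamped value lies on
    that face, where the sign of the speed forbids going further out. The solution thus stays in the
    box and solves the original system. *)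
Theorem trajectory_exists (t0 m0 x0 y0 : R) : in_box ml mh xl xh yl yh m0 x0 y0 ->
  exists m x y : R -> R, [/\ m t0 = m0, x t0 = x0, y t0 = y0 &
    forall t, t0 <= t -> in_box ml mh xl xh yl yh (m t) (x t) (y t) /\
      [/\ is_derive t 1 m (speed_m (m t) (x t) (y t)),
          is_derive t 1 x (speed_r al (m t) (x t)) &
          is_derive t 1 y (speed_r be (m t) (y t))]].
Proof.
move=> [/andP[m1 m2] /andP[x1 x2] /andP[y1 y2]].
have [mlh xlh ylh] :=
  good_box_le _ _ _ _ al0 be0 A0 _ _ _ _ _ _ gb.
have [C C0 [bd lip]] := clamped_field_lipschitz.
have [Y hY] := picard_lindelof_global R 3 clamped_field C C C0 bd lip t0 (vec3 m0 x0 y0).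
pose m := Y 0; pose x := Y 1; pose y := Y 2.
have [em dm] := hY 0; have [ex dx] := hY 1; have [ey dy] := hY 2.
pose z t : 'I_3 -> R := fun j => Y j t.
have cont i t : t0 <= t -> {within `[t0, t], continuous (Y i)}.
  move=> tt; apply: (is_derive_within_continuous _ _ (fun s => clamped_field (z s) i)).
  by move=> s; rewrite in_itv /= => /andP[ts _]; have [_] := hY i; exact.
have dY i t s : s \in `]t0, t[ -> is_derive s 1 (Y i) (clamped_field (z s) i).
  by rewrite in_itv /= => /andP[/ltW ts _]; have [_] := hY i; exact.
have tt_in t : t0 <= t -> t \in `[t0, t] by move=> tt; rewrite in_itv /= tt lexx.
have [cmb cxb cyb] : [/\ forall z, ml <= cm z <= mh, forall z, xl <= cx z <= xh &
    forall z, yl <= cy z <= yh] by split=> ?; exact: clamp_itv.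
have pos lo hi c : 0 < lo -> lo <= c <= hi -> 0 < c :> R.
  by move=> l0 /andP[lc _]; exact: lt_le_trans l0 lc.
have mp z' : 0 < cm z' := pos _ _ _ ml0 (cmb z').
have xp z' : 0 < cx z' := pos _ _ _ xl0 (cxb z').
have yp z' : 0 < cy z' := pos _ _ _ yl0 (cyb z').
have w z' := amgm_box _ _ _ _ _ _ _ _ _ _ gb _ (cmb z').
have box t : t0 <= t -> in_box ml mh xl xh yl yh (m t) (x t) (y t).
  move=> tt; split; apply/andP; split.
  - apply: (barrier_ge _ _ _ _ _ _ (cont 0 t tt) (dY 0 t)) (tt_in t tt).
      by rewrite em.
    move=> s _ h; rewrite /clamped_field /=.
    have e : cm (z s) = ml by exact: clamp_le.
    apply: speed_m_ge0 => //; rewrite e //; exact: ml_le gb.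
  - apply: (barrier_le _ _ _ _ _ _ (cont 0 t tt) (dY 0 t)) (tt_in t tt).
      by rewrite em.
    move=> s _ h; rewrite /clamped_field /=.
    have e : cm (z s) = mh by exact: clamp_ge.
    apply: speed_m_le0 => //; rewrite e //; exact: mh_ge gb.
  - apply: (barrier_ge _ _ _ _ _ _ (cont 1 t tt) (dY 1 t)) (tt_in t tt).
      by rewrite ex.
    move=> s _ h; rewrite /clamped_field /=.
    have e : cx (z s) = xl by exact: clamp_le.
    apply: speed_r_ge0 => //; rewrite e //; exact: xl_le gb.
  - apply: (barrier_le _ _ _ _ _ _ (cont 1 t tt) (dY 1 t)) (tt_in t tt).
      by rewrite ex.
    move=> s _ h; rewrite /clamped_field /=.
    have e : cx (z s) = xh by exact: clamp_ge.
    apply: (speed_r_le0 _ _ _ _ _ (mh + A ^+ 2 / ml)) => //.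
    rewrite e; exact: xh_ge gb.
  - apply: (barrier_ge _ _ _ _ _ _ (cont 2 t tt) (dY 2 t)) (tt_in t tt).
      by rewrite ey.
    move=> s _ h; rewrite /clamped_field /=.
    have e : cy (z s) = yl by exact: clamp_le.
    apply: speed_r_ge0 => //; rewrite e //; exact: yl_le gb.
  - apply: (barrier_le _ _ _ _ _ _ (cont 2 t tt) (dY 2 t)) (tt_in t tt).
      by rewrite ey.
    move=> s _ h; rewrite /clamped_field /=.
    have e : cy (z s) = yh by exact: clamp_ge.
    apply: (speed_r_le0 _ _ _ _ _ (mh + A ^+ 2 / ml)) => //.
    rewrite e; exact: yh_ge gb.
exists m, x, y; split=> // t tt; have bt := box t tt; split=> //.
have [e1 e2 e3] := clamped_field_box _ _ _ bt.
have zE : z t = vec3 (m t) (x t) (y t).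
  by apply/funext; elim/ord3_ind.
split.
- by rewrite -e1 -zE; exact: dm.
- by rewrite -e2 -zE; exact: dx.
- by rewrite -e3 -zE; exact: dy.
Qed.

End ClampedFlow.

(** * The flow of invariant metrics *)

Section InvariantFlow.
Variables (R : realType) (p q : nat) (lam : R).
Hypotheses (q0 : (1 <= q)%N) (qp : (q < p)%N) (lam0 : 0 < lam).
Local Notation n := (p%:R ^+ 2 + q%:R ^+ 2 : R).
Local Notation P := (p%:R : R).
Local Notation Q := (q%:R : R).
Local Notation al := (Q ^+ 2 / (4 * n ^+ 2)).
Local Notation be := (P ^+ 2 / (4 * n ^+ 2)).
Local Notation A := (2 * n * lam).
Local Notation Hlam := (scale3 lam (H_o R p q)).
Local Notation traj := (trajectory R al be A).

Let p0 : (0 < p)%N. Proof. exact: leq_ltn_trans qp. Qed.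
Let P0 : 0 < P. Proof. by rewrite ltr0n. Qed.
Let Q0 : 0 < Q. Proof. by rewrite ltr0n. Qed.
Let n0 : 0 < n. Proof. by rewrite addr_gt0 ?exprn_gt0. Qed.
Let al0 : 0 < al. Proof. by rewrite divr_gt0 ?mulr_gt0 ?exprn_gt0. Qed.
Let be0 : 0 < be. Proof. by rewrite divr_gt0 ?mulr_gt0 ?exprn_gt0. Qed.
Let A0 : 0 < A. Proof. by rewrite !mulr_gt0. Qed.

(** Because A = 2 n lam, lam^2 - m^2/(4n^2) equals (A^2 - m^2)/(4n^2); the denominators 4n^2 are
    absorbed in the coefficients al and be. *)
Lemma metric_field_speed m x y : 0 < m -> 0 < x -> 0 < y ->
  metric_field p q Hlam (Dg m x y) =
  Dg (speed_m R al be A m x y) (speed_r R A al m x) (speed_r R A be m y).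
Proof.
move=> m0 x0 y0; rewrite metric_field_Dg // /speed_m /speed_r.
by congr Dg; field; rewrite ?lt0r_neq0.
Qed.

Lemma lam_g_oE : lam *: g_o R p q = Dg A (2 * al * A) (2 * be * A).
Proof.
rewrite g_oE; apply/matrixP => i j; rewrite mxE !Dg_mxE.
case: (i == j); rewrite ?mulr0n ?mulr0 // !mulr1n.
by elim/ord5_ind: i; rewrite !vec5E; field; rewrite ?lt0r_neq0.
Qed.

(** Each face is placed at the more extreme of the given value and the bound demanded by [good_box];
    boxes of any size are allowed, hence convergence is global. *)
Lemma good_box_exists m x y : 0 < m -> 0 < x -> 0 < y ->
  exists ml mh xl xh yl yh, good_box R al be A ml mh xl xh yl yh /\
    in_box R ml mh xl xh yl yh m x y.
Proof.
move=> m0 x0 y0; exists (Num.min m A), (Num.max m A).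
pose W := Num.max m A + A ^+ 2 / Num.min m A.
exists (Num.min x (2 * al * A)), (Num.max x (al * W)).
exists (Num.min y (2 * be * A)), (Num.max y (be * W)).
have w k : 0 < k -> 0 < 2 * k * A by move=> k0; rewrite !mulr_gt0.
by split; [split; rewrite ?lt_min ?ge_min ?le_max ?lexx ?orbT ?m0 ?x0 ?y0 ?w
  | split; rewrite ?ge_min ?le_max ?lexx].
Qed.

Lemma Dg_coord (m x y : R) :
  (Dg m x y 0 0 = m) * (Dg m x y 1 1 = x) * (Dg m x y 3 3 = y).
Proof. by rewrite !Dg_mxE !vec5E. Qed.

Lemma inv_metrics_coord (g : 'M[R]_5) : inv_metrics p q g ->
  [/\ g = Dg (g 0 0) (g 1 1) (g 3 3), 0 < g 0 0, 0 < g 1 1 & 0 < g 3 3].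
Proof.
by move=> /(inv_metrics_Dg _ _ _ p0 q0 _ qp)[m [x [y [-> ? ? ?]]]]; rewrite !Dg_coord.
Qed.

Lemma ode_solution_trajectory (J : set R) (g : R -> 'M[R]_5) a b :
  `[a, b] `<=` J -> ode_solution (inv_metrics p q) (metric_field p q Hlam) J g ->
  traj a b (fun t => g t 0 0) (fun t => g t 1 1) (fun t => g t 3 3).
Proof.
move=> abJ sol.
have der t : J t -> derivative_within J g t
    (Dg (speed_m R al be A (g t 0 0) (g t 1 1) (g t 3 3))
      (speed_r R A al (g t 0 0) (g t 1 1)) (speed_r R A be (g t 0 0) (g t 3 3))).
  move=> /sol[/inv_metrics_coord[gE ? ? ?]]; rewrite [X in metric_field _ _ _ X]gE.
  by rewrite metric_field_speed.
have dm t : J t -> derivative_within J (fun s => g s 0 0 : R^o) t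
    (speed_m R al be A (g t 0 0) (g t 1 1) (g t 3 3)).
  by move=> /der /derivative_within_mx /(_ 0 0); rewrite Dg_coord.
have dx t : J t -> derivative_within J (fun s => g s 1 1 : R^o) t
    (speed_r R A al (g t 0 0) (g t 1 1)).
  by move=> /der /derivative_within_mx /(_ 1 1); rewrite Dg_coord.
have dy t : J t -> derivative_within J (fun s => g s 3 3 : R^o) t
    (speed_r R A be (g t 0 0) (g t 3 3)).
  by move=> /der /derivative_within_mx /(_ 3 3); rewrite Dg_coord.
split.
- exact: (derivative_within_continuous _ _ _ _ _ _ abJ dm).
- exact: (derivative_within_continuous _ _ _ _ _ _ abJ dx).
- exact: (derivative_within_continuous _ _ _ _ _ _ abJ dy).
- by move=> t /abJ /sol[/inv_metrics_coord[]].
- by move=> t tab; exact: (derivative_within_is_derive _ _ _ _ _ _ _ abJ tab dm).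
- by move=> t tab; exact: (derivative_within_is_derive _ _ _ _ _ _ _ abJ tab dx).
- by move=> t tab; exact: (derivative_within_is_derive _ _ _ _ _ _ _ abJ tab dy).
Qed.

(** Two intervals are allowed so that the solution on the half-line can be compared with a solution
    on any other interval. *)
Lemma ode_solution_unique (J J' : set R) (g g' : R -> 'M[R]_5) a b :
  a <= b -> `[a, b] `<=` J -> `[a, b] `<=` J' ->
  ode_solution (inv_metrics p q) (metric_field p q Hlam) J g ->
  ode_solution (inv_metrics p q) (metric_field p q Hlam) J' g' ->
  g' a = g a -> g' b = g b.
Proof.
move=> ab abJ abJ' sol sol' e.
have inab : a \in `[a, b] /\ b \in `[a, b] by rewrite !in_itv /= !lexx ab.
have [/inv_metrics_coord[_ m0 x0 y0] _] := sol _ (abJ _ inab.1).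
have [/inv_metrics_coord[gE _ _ _] _] := sol _ (abJ _ inab.2).
have [/inv_metrics_coord[gE' _ _ _] _] := sol' _ (abJ' _ inab.2).
have [ml [mh [xl [xh [yl [yh [gb ib]]]]]]] := good_box_exists _ _ _ m0 x0 y0.
have tr := ode_solution_trajectory _ _ _ _ abJ sol.
have tr' := ode_solution_trajectory _ _ _ _ abJ' sol'.
have [] := trajectory_unique _ _ _ _ al0 be0 A0 _ _ _ _ _ _ gb _ _ _ _ _ _ _ _ ab tr tr' ib;
  rewrite ?e // => e1 e2 e3.
by rewrite gE gE' e1 e2 e3.
Qed.

Lemma ode_solution_exists (t0 : R) (g0 : 'M[R]_5) : inv_metrics p q g0 ->
  exists2 g, ode_solution (inv_metrics p q) (metric_field p q Hlam) `[t0, +oo[ g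
    & g t0 = g0.
Proof.
move=> /inv_metrics_coord[gE m0 x0 y0].
have [ml [mh [xl [xh [yl [yh [gb ib]]]]]]] := good_box_exists _ _ _ m0 x0 y0.
have [m [x [y [em ex ey h]]]] :=
  trajectory_exists _ _ _ _ al0 be0 A0 _ _ _ _ _ _ gb t0 _ _ _ ib.
exists (fun t => Dg (m t) (x t) (y t)); last by rewrite em ex ey -gE.
move=> t; rewrite /= in_itv /= andbT => tt.
have [[/andP[m1 _] /andP[x1 _] /andP[y1 _]] [dm dx dy]] := h t tt.
have mt := lt_le_trans (ml_gt0 _ _ _ _ _ _ _ _ _ _ gb) m1.
have xt := lt_le_trans (xl_gt0 _ _ _ _ _ _ _ _ _ _ gb) x1.
have yt := lt_le_trans (yl_gt0 _ _ _ _ _ _ _ _ _ _ gb) y1.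
split; first exact: Dg_inv_metrics.
rewrite metric_field_speed //; apply/derivative_within_mx => i j.
rewrite Dg_mxE; have [<-|ij] := eqVneq i j; last first.
  rewrite (_ : (fun s => _) = cst 0); last first.
    by apply/funext => s; rewrite Dg_mxE (negbTE ij).
  by apply: is_derive_derivative_within; exact: is_derive_cst.
rewrite mulr1n (_ : (fun s => _) = fun s => vec5 (m s) (x s) (x s) (y s) (y s) 0 i);
  last by apply/funext => s; rewrite Dg_mxE eqxx.
have vE s : vec5 (m s) (x s) (x s) (y s) (y s) 0 i =
    nth 0 [:: m s; x s; x s; y s; y s] i.
  by rewrite mxE.
rewrite (funext vE); apply: is_derive_derivative_within.
by elim/ord5_ind: i {vE}; rewrite vec5E.
Qed.

Lemma derivative_within_eq0_cst (J : set R) (b : R -> 'M[R]_5) s t :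
  s <= t -> `[s, t] `<=` J -> (forall u, J u -> derivative_within J b u 0) ->
  b t = b s.
Proof.
move=> st stJ db; apply/matrixP => i j.
have d u : J u -> derivative_within J (fun s => b s i j : R^o) u 0.
  by move=> /db /derivative_within_mx /(_ i j); rewrite mxE.
have c : {within `[s, t], continuous (fun s => b s i j)}.
  exact: (derivative_within_continuous _ _ _ (fun=> 0) _ _ stJ d).
have h : `|b t i j - b s i j| <= 0 - 0.
  apply: (@deriv_dominated R (fun s => b s i j) (fun=> 0) (cst 0) (fun=> 0)) => //.
  - by apply: continuous_subspaceT => u; exact: cvg_cst.
  - by move=> u ust; exact: (derivative_within_is_derive _ _ _ (fun=> 0) _ _ _ stJ ust d).
  - by move=> u _; rewrite normr0.
by apply/eqP; rewrite -subr_eq0 -normr_le0 -(subrr 0).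
Qed.

(** With [lyapunov_upper], compares the Lyapunov function with the squared distance to
    [lam *: g_o R p q] in the entrywise maximum norm, with constants min(K, 1) and K + 2. *)
Lemma lyapunov_lower (K e m x y : R) : 0 < K -> 0 <= e ->
  lyapunov R al be A K m x y <= Num.min K 1 * e ^+ 2 ->
  `|Dg m x y - lam *: g_o R p q| <= e.
Proof.
move=> K0 e0; rewrite /lyapunov lam_g_oE => h.
have [h1 h2 h3] := And3 (sqr_ge0 (m - A)) (sqr_ge0 (x - 2 * al * A))
  (sqr_ge0 (y - 2 * be * A)).
have k0 : 0 < Num.min K 1 by rewrite lt_min K0 ltr01.
have kK : Num.min K 1 * (m - A) ^+ 2 <= K * (m - A) ^+ 2.
  by rewrite ler_wpM2r // ge_min lexx.
have k1 u : 0 <= u -> Num.min K 1 * u <= u :> R.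
  by move=> u0; rewrite ler_piMl // ge_min lexx orbT.
have := k1 _ h2; have := k1 _ h3 => q3 q2.
have K1 : 0 <= K * (m - A) ^+ 2 by rewrite mulr_ge0 // ltW.
have sq u : Num.min K 1 * u ^+ 2 <= Num.min K 1 * e ^+ 2 -> `|u| <= e.
  rewrite ler_pM2l // -(real_normK (num_real u)) ler_sqr ?nnegrE //.
have b1 : `|m - A| <= e by apply: sq; lra.
have b2 : `|x - 2 * al * A| <= e by apply: sq; lra.
have b3 : `|y - 2 * be * A| <= e by apply: sq; lra.
apply/mx_norm_le => // i j; rewrite !mxE -mulrnBl; case: (i == j); last first.
  by rewrite mulr0n normr0.
by rewrite mulr1n; elim/ord5_ind: i.
Qed.

Lemma lyapunov_upper (K d : R) (g : 'M[R]_5) : 0 < K ->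
  `|g - lam *: g_o R p q| <= d ->
  [/\ `|g 0 0 - A| <= d, `|g 1 1 - 2 * al * A| <= d, `|g 3 3 - 2 * be * A| <= d &
    lyapunov R al be A K (g 0 0) (g 1 1) (g 3 3) <= (K + 2) * d ^+ 2].
Proof.
move=> K0; rewrite lam_g_oE => h; have d0 : 0 <= d := le_trans (normr_ge0 _) h.
have {}h := (mx_norm_le _ _ _ _ _ d0).1 h.
have [h1 h2 h3] := And3 (h 0 0) (h 1 1) (h 3 3).
rewrite !mxE /= !mulr1n in h1 h2 h3; split=> //.
have sq u : `|u| <= d -> u ^+ 2 <= d ^+ 2.
  by rewrite -(real_normK (num_real u)) ler_sqr ?nnegrE.
rewrite /lyapunov; have := ler_wpM2l (ltW K0) (sq _ h1).
have := sq _ h2; have := sq _ h3; lra.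
Qed.

Lemma ode_solution_lyapunov
  ml mh xl xh yl yh :
  good_box R al be A ml mh xl xh yl yh ->
  exists K rho : R, [/\ 0 < K, 0 < rho & forall (J : set R) (g : R -> 'M[R]_5) (t0 t : R),
    ode_solution (inv_metrics p q) (metric_field p q Hlam) J g ->
    in_box R ml mh xl xh yl yh (g t0 0 0) (g t0 1 1) (g t0 3 3) ->
    t0 <= t -> `[t0, t] `<=` J ->
    lyapunov R al be A K (g t 0 0) (g t 1 1) (g t 3 3) <=
    lyapunov R al be A K (g t0 0 0) (g t0 1 1) (g t0 3 3) * expR (- rho * (t - t0))].
Proof.
move=> gb; have [K [rho [K0 rho0 h]]] :=
  trajectory_decay _ _ _ _ al0 be0 A0 _ _ _ _ _ _ gb.
exists K, rho; split=> // J g t0 t sol ib tt tJ.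
exact: (h _ _ _ _ _ tt (ode_solution_trajectory _ _ _ _ tJ sol) ib).
Qed.

Lemma ode_solution_cvg (g : R -> 'M[R]_5) (t0 : R) :
  ode_solution (inv_metrics p q) (metric_field p q Hlam) `[t0, +oo[ g ->
  g t @[t --> +oo] --> lam *: g_o R p q.
Proof.
move=> sol; have in0 t : t0 <= t -> `[t0, +oo[%classic t by rewrite /= in_itv /= andbT.
have [/inv_metrics_coord[gE m0 x0 y0] _] := sol t0 (in0 _ (lexx _)).
have [ml [mh [xl [xh [yl [yh [gb ib]]]]]]] := good_box_exists _ _ _ m0 x0 y0.
have [K [rho [K0 rho0 h]]] := ode_solution_lyapunov _ _ _ _ _ _ gb.
set E0 := lyapunov R al be A K (g t0 0 0) (g t0 1 1) (g t0 3 3) in h.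
have E00 : 0 <= E0.
  exact: (addr_ge0 (addr_ge0 (mulr_ge0 (ltW K0) (sqr_ge0 _)) (sqr_ge0 _)) (sqr_ge0 _)).
have k0 : 0 < Num.min K 1 by rewrite lt_min K0 ltr01.
apply/cvgrPdist_le => e e0; near=> t.
(* The threshold comes from rho s <= exp(rho s), s = t - t0: beyond it, E0 exp(-rho s) is at most
   min(K, 1) e^2. *)
have t1 : t0 + E0 / (rho * (Num.min K 1 * e ^+ 2)) <= t.
  by near: t; apply: nbhs_pinfty_ge; rewrite num_real.
have de0 : 0 < Num.min K 1 * e ^+ 2 by rewrite mulr_gt0 ?exprn_gt0.
have tt : t0 <= t.
  by apply: le_trans t1; rewrite lerDl; exact: divr_ge0 E00 (ltW (mulr_gt0 rho0 de0)).
have [/inv_metrics_coord[gtE _ _ _] _] := sol t (in0 _ tt).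
rewrite distrC gtE; apply: (lyapunov_lower K) => //; first exact: ltW.
apply: le_trans (h _ _ _ _ sol ib tt _) _.
  by move=> s; rewrite /= !in_itv /= => /andP[-> _].
rewrite -/E0 mulNr expRN ler_pdivrMr ?expR_gt0 //.
have := expR_ge1Dx (rho * (t - t0)) => e1.
apply: (@le_trans _ _ (Num.min K 1 * e ^+ 2 * (rho * (t - t0)))); last first.
  by rewrite ler_pM2l //; lra.
move: t1; rewrite -lerBrDl ler_pdivrMr ?mulr_gt0 // => /le_trans; apply.
by rewrite le_eqVlt; apply/orP; left; apply/eqP; ring.
Unshelve. all: by end_near.
Qed.

Lemma ode_solution_stable : asymptotically_stable (inv_metrics p q)
  (metric_field p q Hlam) (lam *: g_o R p q).
Proof.
have al1 : 0 < 2 * al * A := mulr_gt0 (mulr_gt0 (ltr0Sn R 1) al0) A0.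
have be1 : 0 < 2 * be * A := mulr_gt0 (mulr_gt0 (ltr0Sn R 1) be0) A0.
split.
- by rewrite lam_g_oE; exact: Dg_inv_metrics.
- rewrite lam_g_oE metric_field_speed // (_ : Dg _ _ _ = Dg 0 0 0).
    by apply/matrixP => i j; rewrite Dg_mxE [RHS]mxE; elim/ord5_ind: i; rewrite vec5E mul0rn.
  rewrite /speed_m /speed_r; have An0 := lt0r_neq0 A0.
  move: (lt0r_neq0 al0) (lt0r_neq0 be0) An0; move: (al) (be) (A) => a b c ha hb hc.
  by congr Dg; field; rewrite ?ha ?hb ?hc.
- pose cx := al * A; pose cy := be * A.
  have cx0 : 0 < cx := mulr_gt0 al0 A0.
  have cy0 : 0 < cy := mulr_gt0 be0 A0.
  (* The box is independent of the tolerance, so [K] and [rho] are fixed before the radius. Each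
     coordinate ranges from half to twice its equilibrium value, as mh + A^2/ml is here 4A. *)
  have gb : good_box R al be A (A / 2) (2 * A) cx (4 * cx) cy (4 * cy).
    have AE : 2 * A + A ^+ 2 / (A / 2) = 4 * A.
      by have := lt0r_neq0 A0; move: (A) => u u0; field.
    have kE k : k * (4 * A) = 4 * (k * A) by rewrite mulrCA.
    split; rewrite ?AE ?kE -?(mulrA 2 al A) -?(mulrA 2 be A) -/cx -/cy //;
      try (by rewrite divr_gt0);
      move: cx0 cy0 A0; move: (cx) (cy) (A) => u v w *; lra.
  have [K [rho [K0 rho0 h]]] := ode_solution_lyapunov _ _ _ _ _ _ gb.
  move=> e e0; pose d0 := Num.min (A / 2) (Num.min cx cy).
  have k0 : 0 < Num.min K 1 by rewrite lt_min K0 ltr01.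
  have k1 : Num.min K 1 <= 1 by rewrite ge_min lexx orbT.
  pose c := Num.min K 1 / (K + 2).
  have K2 : 0 < K + 2 by rewrite addr_gt0.
  have c0 : 0 < c by rewrite divr_gt0.
  (* [d0] keeps the starting metric in the box. The other bound makes the initial Lyapunov value at
     most (K + 2)(c e/2)^2 = min(K, 1)(e/2)^2 c with c <= 1; half of e leaves room for the strict
     inequality. *)
  exists (Num.min d0 (e / 2 * c)).
    by rewrite !lt_min !divr_gt0 // cx0 cy0 mulr_gt0 ?divr_gt0.
  move=> J g Ji J0 Jpos sol hg t Jt.
  have tt : 0 <= t by have := Jpos t Jt; rewrite /= in_itv /= andbT.
  have tJ : `[0, t] `<=` J.
    by move=> s; rewrite /= in_itv /= => st; exact: Ji st.
  have [b1 b2 b3 b4] := lyapunov_upper K _ _ K0 (ltW hg).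
  rewrite -(mulrA 2 al A) -/cx in b2; rewrite -(mulrA 2 be A) -/cy in b3.
  have dd0 : Num.min d0 (e / 2 * c) <= d0 by rewrite ge_min lexx.
  have dA : d0 <= A / 2 by rewrite ge_min lexx.
  have dx : d0 <= cx by rewrite !ge_min lexx !orbT.
  have dy : d0 <= cy by rewrite !ge_min lexx !orbT.
  have ib : in_box R (A / 2) (2 * A) cx (4 * cx) cy (4 * cy) (g 0 0 0) (g 0 1 1) (g 0 3 3).
    split; [|exact: dist_double_le b2 (le_trans dd0 dx)
             |exact: dist_double_le b3 (le_trans dd0 dy)].
    have hA (u : R) : u = 2 * (u / 2) by field.
    have := dist_double_le _ _ (A / 2) _ _ (le_trans dd0 dA); rewrite -hA.
    by move=> /(_ _ b1); rewrite (_ : 4 * (A / 2) = 2 * A) //; field.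
  have [/inv_metrics_coord[gtE _ _ _] _] := sol t Jt.
  apply: (@le_lt_trans _ _ (e / 2)); last by lra.
  rewrite gtE; apply: (lyapunov_lower K) => //; first by rewrite divr_ge0 // ltW.
  apply: le_trans (h _ _ _ _ sol ib tt tJ) _.
  set E0 := lyapunov _ _ _ _ _ _ _ _ in b4 *.
  have E00 : 0 <= E0.
    exact: (addr_ge0 (addr_ge0 (mulr_ge0 (ltW K0) (sqr_ge0 _)) (sqr_ge0 _)) (sqr_ge0 _)).
  have ex1 : expR (- rho * (t - 0)) <= 1.
    by rewrite -expR0 ler_expR subr0 mulNr oppr_le0 mulr_ge0 // ltW.
  apply: (@le_trans _ _ E0); first by rewrite ler_piMr.
  apply: le_trans b4 _; set d := Num.min d0 _.
  have d_ge0 : 0 <= d by exact: le_trans (normr_ge0 _) (ltW hg).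
  have de : d <= e / 2 * c by rewrite /d ge_min lexx orbT.
  have c1 : c <= 1 by rewrite ler_pdivrMr // mul1r; lra.
  have cE : (K + 2) * c = Num.min K 1 by rewrite mulrC divfK // lt0r_neq0.
  apply: (@le_trans _ _ ((K + 2) * (e / 2 * c) ^+ 2)).
    by rewrite ler_pM2l // ler_sqr ?nnegrE // (le_trans d_ge0).
  rewrite (_ : _ * _ ^+ 2 = Num.min K 1 * (e / 2) ^+ 2 * c); last by rewrite -cE; ring.
  by rewrite ler_piMr // mulr_ge0 ?sqr_ge0 ?(ltW k0).
(* Any radius would do: existence and convergence hold for every invariant initial metric. *)
- exists 1 => //; split=> [g0 Mg0 _|g sol _].
    exact: ode_solution_exists.
  exact: ode_solution_cvg sol.
Qed.

End InvariantFlow.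

(** * Global existence, convergence and stability for the generalized Ricci flow *)

Theorem mainTheorem4 (R : realType) (p q : nat) (lam t0 : R) (g : 'M[R]_5)
    (hq : (1 <= q)%N) (hqp : (q < p)%N) (hpq : coprime p q)
    (hlam : 0 < lam) (hg : inv_metrics p q g) :
  let Hlam := scale3 lam (H_o R p q) in
  [/\ grf_fixed_point p q (g_o R p q) (H_o R p q),
      forall (J : set R) (gt bt : R -> 'M[R]_5),
        is_interval J -> J t0 -> grf_solution p q Hlam t0 g J gt bt ->
        forall t, J t -> torsion p q Hlam (bt t) = Hlam,
      exists gt bt : R -> 'M[R]_5,
        [/\ grf_solution p q Hlam t0 g `[t0, +oo[ gt bt,
            forall (J : set R) (gt' bt' : R -> 'M[R]_5),
              is_interval J -> J t0 -> grf_solution p q Hlam t0 g J gt' bt' ->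
              forall t, J t -> t0 <= t -> gt' t = gt t /\ bt' t = bt t &
            gt t @[t --> +oo] --> lam *: g_o R p q] &
      asymptotically_stable (inv_metrics p q) (metric_field p q Hlam)
        (lam *: g_o R p q)].
Proof.
move=> Hlam; have p0 : (0 < p)%N by exact: leq_ltn_trans hqp.
have tors b : inv_2forms p q b -> torsion p q Hlam b = Hlam.
  exact: torsion_invariant.
have ode (J : set R) gt bt : grf_solution p q Hlam t0 g J gt bt ->
    ode_solution (inv_metrics p q) (metric_field p q Hlam) J gt.
  by move=> [_ _ sol] t /sol[? /tors tE dg _]; rewrite tE in dg.
have coord (h : 'M[R]_5) : inv_metrics p q h ->
    [/\ h = Dg (h 0 0) (h 1 1) (h 3 3), 0 < h 0 0, 0 < h 1 1 & 0 < h 3 3].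
  exact: (inv_metrics_coord R p q hq hqp h).
have codiff0 (h : 'M[R]_5) H w : inv_metrics p q h -> is_codiff p q h H w <-> w = 0.
  by move=> /coord[hE m0 x0 y0]; rewrite hE; exact: codiff_eq0.
split.
- have e1 : scale3 1 (H_o R p q) = H_o R p q.
    by do 3!apply/funext => ?; rewrite /scale3 mul1r.
  (* That (g_o, H_o) is a fixed point is the case lam = 1 of the equilibrium contained in asymptotic
     stability. *)
  have [inv0 eq0 _ _] := ode_solution_stable R p q 1 hq hqp ltr01.
  by rewrite scale1r in inv0 eq0; rewrite e1 in eq0; split=> //; apply/codiff0.
- by move=> J gt bt _ _ [_ _ sol] t /sol[_ /tors].
- have [gt sol g0] := ode_solution_exists R p q lam hq hqp hlam t0 g hg.
  exists gt, (fun=> 0); split; last exact: (ode_solution_cvg R p q lam hq hqp hlam gt t0 sol).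
    split=> // t tJ; have [Mt dt] := sol t tJ; split=> //.
    + exact: inv_2forms0.
    + by rewrite tors //; exact: inv_2forms0.
    + exists 0; first exact/codiff0.
      apply/derivative_within_mx => i j; rewrite oppr0 mxE.
      exact: is_derive_derivative_within.
  move=> J gt' bt' Ji Jt0 sol' t Jt tt; have sub : `[t0, t] `<=` J.
    by move=> s; rewrite /= in_itv /= => st; exact: Ji st.
  have sub' : `[t0, t] `<=` `[t0, +oo[.
    by move=> s; rewrite /= !in_itv /= => /andP[-> _].
  have ode' := ode _ _ _ sol'; have [g0' b0' sol''] := sol'.
  split.
    apply: (ode_solution_unique R p q lam hq hqp hlam _ _ _ _ _ _ tt sub' sub sol ode').
    by rewrite g0' g0.
  (* The codifferential vanishes along any solution, so the 2-form keeps its initial value 0. *)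
  rewrite -b0'; apply: derivative_within_eq0_cst tt sub _ => s /sol''[Ms _ _ [w]].
  by move=> /(codiff0 _ _ _ Ms) ->; rewrite oppr0.
- exact: ode_solution_stable.
Qed.
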